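(* Let $M$ be a (connected) hypersurface isometrically immersed in a semi-Riemannian space of constant curvature $N_s^{n+1}(c)$, $n=\dim M\geq4$, where $c=\frac{\widetilde\kappa}{n(n+1)}$ and $\widetilde\kappa$ is the scalar curvature of $N_s^{n+1}(c)$. Then on $M$ $$C\cdot R+R\cdot C=Q(S,C)-\frac{(n-2)\widetilde\kappa}{n(n+1)}\,Q(g,C)+C\cdot C-\frac1{(n-2)^2}\,Q\Big(g,\frac{n-2}2\,S\wedge S-\kappa\,g\wedge S+g\wedge S^2\Big).$$ Moreover, if $C\cdot C=L_C\,Q(g,C)$ on ${\mathcal U}_S\cap{\mathcal U}_C\subset M$ for some function $L_C$, then on this set $$C\cdot R+R\cdot C=Q(S,C)+\Big(L_C-\frac{(n-2)\widetilde\kappa}{n(n+1)}\Big)Q(g,C)-\frac1{(n-2)^2}\,Q\Big(g,\frac{n-2}2\,S\wedge S-\kappa\,g\wedge S+g\wedge S^2\Big).$$ If $M$ is a quasi-Einstein hypersurface satisfying $\mathrm{rank}(S-\alpha g)=1$ (for some function $\alpha$) and $C\cdot C=L_C\,Q(g,C)$ on ${\mathcal U}_S\cap{\mathcal U}_C$, then on this set $$C\cdot R+R\cdot C=Q(S,C)+\Big(L_C-\frac{(n-2)\widetilde\kappa}{n(n+1)}\Big)Q(g,C).$$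
   Context: All manifolds are connected, paracompact and of class $C^\infty$. $N_s^{n+1}(c)$ is an $(n+1)$-dimensional semi-Riemannian space of constant sectional curvature $c$ with signature $(s,n+1-s)$; $g$ is the induced (non-degenerate) metric on $M$. For a semi-Riemannian manifold $(M,g)$, $n=\dim M$, with Levi-Civita connection $\nabla$: ${\mathcal R}(X,Y)Z=\nabla_X\nabla_YZ-\nabla_Y\nabla_XZ-\nabla_{[X,Y]}Z$, $R(X_1,X_2,X_3,X_4)=g({\mathcal R}(X_1,X_2)X_3,X_4)$, $S(X,Y)=\mathrm{tr}\{Z\mapsto{\mathcal R}(Z,X)Y\}$, $g({\mathcal S}X,Y)=S(X,Y)$, $S^2(X,Y)=S({\mathcal S}X,Y)$, $\kappa=\mathrm{tr}\,{\mathcal S}$. For symmetric $(0,2)$-tensors $E,F$: $(E\wedge F)(X_1,X_2,X_3,X_4)=E(X_1,X_4)F(X_2,X_3)+E(X_2,X_3)F(X_1,X_4)-E(X_1,X_3)F(X_2,X_4)-E(X_2,X_4)F(X_1,X_3)$; $G=\frac12g\wedge g$; $C=R-\frac1{n-2}g\wedge S+\frac\kappa{(n-2)(n-1)}G$ is the Weyl tensor. For $B\in\{R,C\}$ define ${\mathcal B}$ by $g({\mathcal B}(X_1,X_2)X_3,X_4)=B(X_1,X_2,X_3,X_4)$; for a $(0,k)$-tensor $T$, $(B\cdot T)(X_1,\dots,X_k,X,Y)=-\sum_iT(X_1,\dots,{\mathcal B}(X,Y)X_i,\dots,X_k)$. For a symmetric $(0,2)$-tensor $A$, $(X\wedge_AY)Z=A(Y,Z)X-A(X,Z)Y$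 and $Q(A,T)(X_1,\dots,X_k,X,Y)=-\sum_iT(X_1,\dots,(X\wedge_AY)X_i,\dots,X_k)$. ${\mathcal U}_S$ is the set of points where $S\ne\frac\kappa ng$; ${\mathcal U}_C$ is the set of points where $C\neq0$. *)

(* Defs.v *)
From mathcomp Require Import all_boot all_order all_algebra.
From mathcomp Require Import all_classical all_reals all_analysis.

Set Implicit Arguments.
Unset Strict Implicit.
Unset Printing Implicit Defensive.

Import Order.TTheory GRing.Theory Num.Theory.
Import numFieldNormedType.Exports.

Local Open Scope classical_set_scope.
Local Open Scope ring_scope.

(* A tangent space of an n-manifold is represented by 'rV[R]_n (components of
   a vector in a chart); covariant tensors are functions of vectors, and the
   metric at a point is given by its Gram matrix. *)

Section Tensors.
Context {R : realType} {n : nat}.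
Local Notation V := 'rV[R]_n.
Implicit Types (g : 'M[R]_n) (E F A S : V -> V -> R).
Implicit Types (B T : V -> V -> V -> V -> R).

Definition bil g (u v : V) : R := (u *m g *m v^T) 0 0.

(* The vector W with bil g W X = l X for all X, when l is linear and g is
   symmetric and invertible. *)
Definition sharp g (l : V -> R) : V :=
  (\row_i l (delta_mx 0 i)) *m invmx g.

Definition trace (L : V -> V) : R := \tr (lin1_mx L).

Definition ricci_of (Rop : V -> V -> V -> V) : V -> V -> R :=
  fun X Y => trace (fun Z => Rop Z X Y).

Definition ricci_op g S : V -> V := fun X => sharp g (S X).

Definition square g S : V -> V -> R := fun X Y => S (ricci_op g S X) Y.

Definition scal_of g S : R := trace (ricci_op g S).

Definition wedge E F : V -> V -> V -> V -> R := fun X1 X2 X3 X4 =>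
  E X1 X4 * F X2 X3 + E X2 X3 * F X1 X4
  - E X1 X3 * F X2 X4 - E X2 X4 * F X1 X3.

Definition Gtensor g : V -> V -> V -> V -> R := fun X1 X2 X3 X4 =>
  2^-1 * wedge (bil g) (bil g) X1 X2 X3 X4.

Definition weyl_of g B S : V -> V -> V -> V -> R := fun X1 X2 X3 X4 =>
  B X1 X2 X3 X4
  - (n%:R - 2)^-1 * wedge (bil g) S X1 X2 X3 X4
  + scal_of g S / ((n%:R - 2) * (n%:R - 1)) * Gtensor g X1 X2 X3 X4.

(* The endomorphism L(X1,X2) with g(L(X1,X2)X3, X4) = B(X1,X2,X3,X4). *)
Definition endo g B : V -> V -> V -> V := fun X1 X2 X3 =>
  sharp g (B X1 X2 X3).

(* For an endomorphism L and a (0,4)-tensor T,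
   - T(L X1, X2, X3, X4) - ... - T(X1, X2, X3, L X4). *)
Definition derivation (L : V -> V) T : V -> V -> V -> V -> R :=
  fun X1 X2 X3 X4 =>
  - (T (L X1) X2 X3 X4 + T X1 (L X2) X3 X4
     + T X1 X2 (L X3) X4 + T X1 X2 X3 (L X4)).

Definition dot g B T : V -> V -> V -> V -> V -> V -> R :=
  fun X1 X2 X3 X4 X Y => derivation (endo g B X Y) T X1 X2 X3 X4.

Definition wedge_op A (X Y : V) : V -> V := fun Z => A Y Z *: X - A X Z *: Y.

Definition Q A T : V -> V -> V -> V -> V -> V -> R :=
  fun X1 X2 X3 X4 X Y => derivation (wedge_op A X Y) T X1 X2 X3 X4.

Definition form_mx A : 'M[R]_n :=
  \matrix_(i, j) A (delta_mx 0 i) (delta_mx 0 j).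

(* Signature (s, n - s): s negative squares and n - s positive ones. *)
Definition gram_signature g (s : nat) : Prop :=
  (s <= n)%N /\ exists2 P : 'M[R]_n, P \in unitmx &
    P *m g *m P^T = diag_mx (\row_(i < n) if (i < s)%N then -1 else 1).

End Tensors.

Section LocalGeometry.
Context {R : realType} {n : nat}.
Local Notation V := 'rV[R]_n.
Variable g : V -> 'M[R]_n.
Implicit Types X Y Z : V -> V.

(* Christoffel symbols, by the Koszul formula for constant vector fields:
   2 g(Gamma(u,v), w) = D_u g(v,w) + D_v g(u,w) - D_w g(u,v). *)
Definition christoffel (x u v : V) : V :=
  sharp (g x) (fun w => 2^-1 *
    ('D_u (fun y => bil (g y) v w) x + 'D_v (fun y => bil (g y) u w) x
     - 'D_w (fun y => bil (g y) u v) x)).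

Definition nabla X Y : V -> V := fun x =>
  'D_(X x) Y x + christoffel x (X x) (Y x).

Definition bracket X Y : V -> V := fun x => 'D_(X x) Y x - 'D_(Y x) X x.

Definition curvature X Y Z : V -> V := fun x =>
  nabla X (nabla Y Z) x - nabla Y (nabla X Z) x - nabla (bracket X Y) Z x.

(* Curvature on tangent vectors at x; as the curvature is tensorial they may
   be extended to any vector fields, here to constant ones. *)
Definition curvature_at (x u v w : V) : V :=
  curvature (cst u) (cst v) (cst w) x.

End LocalGeometry.

(* C^oo on an open set A: all iterated directional derivatives of f exist and
   are (Frechet) differentiable, hence continuous, on A. *)
Fixpoint diff_times {R : realType} {V W : normedModType R} (k : nat)
    (A : set V) (f : V -> W) : Prop :=
  if k is k'.+1 then
    (forall x, A x -> differentiable f x) /\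
    (forall v, diff_times k' A ('D_v f))
  else forall x, A x -> {for x, continuous f}.

Definition smooth_on {R : realType} {V W : normedModType R}
    (A : set V) (f : V -> W) : Prop := forall k, diff_times k A f.

Definition paracompact (T : topologicalType) : Prop :=
  forall C : set (set T), (forall U, C U -> open U) -> \bigcup_(U in C) U = setT ->
  exists D : set (set T),
    [/\ forall U, D U -> open U,
        \bigcup_(U in D) U = setT,
        forall U, D U -> exists2 U', C U' & U `<=` U' &
        forall x : T, exists2 W, nbhs x W &
          finite_set [set U | D U /\ U `&` W !=set0] ].

(* cinv is only meaningful on the image of cdom under cmap. *)
Record chart (R : realType) (n : nat) (T : topologicalType) := Chart {
  cdom : set T;
  cmap :> T -> 'rV[R]_n;
  cinv : 'rV[R]_n -> T }.

Definition is_chart {R : realType} {n : nat} {T : topologicalType}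
    (phi : chart R n T) : Prop :=
  [/\ open (cdom phi), open (phi @` cdom phi),
      forall p, cdom phi p -> cinv phi (phi p) = p,
      forall p, cdom phi p -> {for p, continuous phi} &
      forall x, (phi @` cdom phi) x -> {for x, continuous (cinv phi)} ].

(* The atlas need not be maximal: all notions below are invariant under a
   smooth change of chart. *)
Record manifold (R : realType) (n : nat) := Manifold {
  points :> topologicalType;
  atlas : set (chart R n points);
  atlas_chart : forall phi, atlas phi -> is_chart phi;
  atlas_cover : forall p, exists2 phi, atlas phi & cdom phi p;
  atlas_compat : forall phi psi, atlas phi -> atlas psi ->
    smooth_on (phi @` (cdom phi `&` cdom psi)) (psi \o cinv phi);
  manifold_nonempty : [set: points] !=set0;
  manifold_connected : connected [set: points];
  manifold_hausdorff : hausdorff_space points;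
  manifold_paracompact : paracompact points }.

Definition chart_at {R : realType} {n : nat} {M : manifold R n}
    (p : M) (phi : chart R n M) : Prop := atlas phi /\ cdom phi p.

(* gram phi p is the Gram matrix of the metric at p in the coordinate basis of
   the chart phi; it is meaningful only when phi is a chart at p. *)
Record metric (R : realType) (n : nat) (M : manifold R n) := Metric {
  gram :> chart R n M -> M -> 'M[R]_n;
  gram_sym : forall p phi, chart_at p phi -> (gram phi p)^T = gram phi p;
  gram_nondeg : forall p phi, chart_at p phi -> gram phi p \in unitmx;
  gram_smooth : forall phi, atlas phi -> forall i j,
    smooth_on (phi @` cdom phi) (fun x => gram phi (cinv phi x) i j : R);
  gram_change : forall p phi psi, chart_at p phi -> chart_at p psi ->
    forall u v : 'rV[R]_n,
    bil (gram phi p) u v =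
    bil (gram psi p) ('d (psi \o cinv phi) (phi p) u)
                     ('d (psi \o cinv phi) (phi p) v) }.

Section Curvature.
Context {R : realType} {n : nat} {M : manifold R n}.
Variables (g : metric M) (phi : chart R n M) (p : M).
Local Notation V := 'rV[R]_n.

(* Components at p, in the chart phi, of the tensors of (M, g). *)

Definition gT : V -> V -> R := bil (g phi p).

Definition Rop : V -> V -> V -> V :=
  curvature_at (fun x => g phi (cinv phi x)) (phi p).

Definition Riem : V -> V -> V -> V -> R :=
  fun X1 X2 X3 X4 => gT (Rop X1 X2 X3) X4.

Definition Ric : V -> V -> R := ricci_of Rop.

Definition Ric2 : V -> V -> R := square (g phi p) Ric.

Definition scal : R := scal_of (g phi p) Ric.

Definition Weyl : V -> V -> V -> V -> R := weyl_of (g phi p) Riem Ric.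


Definition dotT (B T : V -> V -> V -> V -> R) := dot (g phi p) B T.

End Curvature.

Definition US {R : realType} {n : nat} {M : manifold R n} (g : metric M) : set M :=
  [set p | exists2 phi, chart_at p phi &
     exists X Y, Ric g phi p X Y <> scal g phi p / n%:R * gT g phi p X Y].

Definition UC {R : realType} {n : nat} {M : manifold R n} (g : metric M) : set M :=
  [set p | exists2 phi, chart_at p phi &
     exists X1 X2 X3 X4, Weyl g phi p X1 X2 X3 X4 <> 0].

Definition has_signature {R : realType} {n : nat} {M : manifold R n}
    (g : metric M) (s : nat) : Prop :=
  forall p phi, chart_at p phi -> gram_signature (g phi p) s.

(* Every nondegenerate tangent plane has sectional curvature c. *)
Definition constant_curvature {R : realType} {n : nat} {M : manifold R n}
    (g : metric M) (c : R) : Prop :=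
  forall p phi, chart_at p phi -> forall u v,
  let area := gT g phi p u u * gT g phi p v v - gT g phi p u v ^+ 2 in
  area != 0 -> Riem g phi p u v v u / area = c.

Definition scalar_curvature_is {R : realType} {n : nat} {M : manifold R n}
    (g : metric M) (k : R) : Prop :=
  forall p phi, chart_at p phi -> scal g phi p = k.

Definition isometric_immersion {R : realType} {m n : nat}
    {M : manifold R m} {N : manifold R n}
    (g : metric M) (h : metric N) (f : M -> N) : Prop :=
  continuous f /\
  forall phi psi, atlas phi -> atlas psi ->
  let F := psi \o f \o cinv phi in
  smooth_on (phi @` (cdom phi `&` f @^-1` cdom psi)) F /\
  forall p, cdom phi p -> cdom psi (f p) ->
    (forall u, 'd F (phi p) u = 0 -> u = 0) /\
    (forall u v, gT g phi p u v =
       gT h psi (f p) ('d F (phi p) u) ('d F (phi p) v)).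

(* rank (S - alpha g) = 1 on U_S; outside U_S this rank is 0 or n. *)
Definition quasi_einstein {R : realType} {n : nat} {M : manifold R n}
    (g : metric M) (alpha : M -> R) : Prop :=
  forall p phi, US g p -> chart_at p phi ->
  \rank (form_mx (fun X Y => Ric g phi p X Y - alpha p * gT g phi p X Y)) = 1%N.

Definition weyl_pseudosymmetric_on {R : realType} {n : nat} {M : manifold R n}
    (g : metric M) (U : set M) (L : M -> R) : Prop :=
  forall p phi, U p -> chart_at p phi -> forall X1 X2 X3 X4 X Y,
  dotT g phi p (Weyl g phi p) (Weyl g phi p) X1 X2 X3 X4 X Y =
  L p * Q (gT g phi p) (Weyl g phi p) X1 X2 X3 X4 X Y.

(* Main.v *)
(** Gauss's equation gives R = e/2 H/\H + c G at every point, with H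
    symmetric and e = h(xi, xi) for a normal vector xi, not necessarily of unit
    length.  Hence
    R.R = Q(S,R) - (n-2) c Q(g,C).  Put D = R - C, a combination of g/\S and G;
    then C.R + R.C - C.C = R.R - D.D, and D.D only involves S and its square.
    When S = alpha g + (a form of rank one), the last tensor of the formula is a
    multiple of g/\g, which Q(g, -) kills.

    Gauss's equation is obtained from the Christoffel symbols of the first kind,
    G(u,v,w) = g(Gam(u,v), w), for which
      R(u,v,w,z) = D_u G(v,w,z) - D_v G(u,w,z)
                   - g(Gam(v,w), Gam(u,z)) + g(Gam(u,w), Gam(v,z)),
    and which an isometric immersion F transforms by
      G(v,w,z) = G'(D_v F, D_w F, D_z F) + h(D_v D_w F, D_z F);
    differentiating once more, the third derivatives of F cancel by symmetry of
    partial derivatives. *)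

Require Import Defs.
From mathcomp Require Import all_boot all_order all_algebra.
From mathcomp Require Import all_classical all_reals all_analysis.
From mathcomp Require Import ring lra.
Import Order.TTheory GRing.Theory Num.Theory.
Import numFieldNormedType.Exports.
Set Implicit Arguments.
Unset Strict Implicit.
Unset Printing Implicit Defensive.
Local Open Scope classical_set_scope.
Local Open Scope ring_scope.

(** * Bilinear forms and curvature algebra *)

(** The pointwise half is polynomial: g, h and h g^-1 h are symmetric matrices, tensors are expanded
    into their values on six vectors, and [ring] or [field] decides. Two facts organise the outcome:
    Q(A, A/\A) = 0 and its polarization Q(A, A/\B) = -1/2 Q(B, A/\A). They make the trace of h g^-1
    drop out of R.R, and they allow D.D to be written in several ways; the form containing Q(S,D) is
    chosen because Q(S,R) - Q(S,D) = Q(S,C).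

    The analytic half prefers the lowered symbols because they are linear in the first derivatives
    of the metric. Gam itself involves the inverse matrix; it is only shown to be derivable, and its
    derivative is always paired with g.

    Constant curvature is a condition on nondegenerate planes, while an indefinite metric also has
    degenerate ones. The usual polarization of sectional curvature therefore has to be preceded by a
    polynomial argument that extends the condition to all planes. *)

Section BilinearForms.
Context {R : realType} {n : nat}.
Local Notation V := 'rV[R]_n.
Implicit Types (g : 'M[R]_n) (u v w : V).

Lemma bilDl g u v w : bil g (u + v) w = bil g u w + bil g v w.
Proof. by rewrite /bil !mulmxDl mxE. Qed.

Lemma bilZl g a u w : bil g (a *: u) w = a * bil g u w.
Proof. by rewrite /bil -!scalemxAl mxE. Qed.

Lemma bilDr g u v w : bil g w (u + v) = bil g w u + bil g w v.
Proof. by rewrite /bil linearD mulmxDr mxE. Qed.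

Lemma bilZr g a u w : bil g w (a *: u) = a * bil g w u.
Proof. by rewrite /bil linearZ -scalemxAr mxE. Qed.

Lemma bilNl g u w : bil g (- u) w = - bil g u w.
Proof. by rewrite -scaleN1r bilZl mulN1r. Qed.

Lemma bilNr g u w : bil g w (- u) = - bil g w u.
Proof. by rewrite -scaleN1r bilZr mulN1r. Qed.

Lemma bil0l g u : bil g 0 u = 0.
Proof. by rewrite /bil !mul0mx mxE. Qed.

Lemma bil0r g u : bil g u 0 = 0.
Proof. by rewrite /bil trmx0 mulmx0 mxE. Qed.

Definition bilE := (bilDl, bilDr, bilNl, bilNr, bilZl, bilZr).

Lemma bil_mxD g g' u v : bil (g + g') u v = bil g u v + bil g' u v.
Proof. by rewrite /bil mulmxDr mulmxDl mxE. Qed.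

Lemma bil_mxZ a g u v : bil (a *: g) u v = a * bil g u v.
Proof. by rewrite /bil -scalemxAr -scalemxAl mxE. Qed.

Lemma bil_mxN g u v : bil (- g) u v = - bil g u v.
Proof. by rewrite -scaleN1r bil_mxZ mulN1r. Qed.

Definition bil_mxE := (bil_mxD, bil_mxN, bil_mxZ).

Lemma bil_sym g u v : g^T = g -> bil g u v = bil g v u.
Proof.
move=> gs; rewrite /bil (_ : u *m g *m v^T = (v *m g *m u^T)^T) ?mxE//.
by rewrite !trmx_mul trmxK gs mulmxA.
Qed.

(** Puts the two arguments of a symmetric form in the order X1, ..., X6, so that equal values become
    a single atom for [ring]. *)
Definition bil_sort6 k X1 X2 X3 X4 X5 X6 (ks : k^T = k) :=
  (bil_sym X2 X1 ks, bil_sym X3 X1 ks, bil_sym X4 X1 ks, bil_sym X5 X1 ks,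
   bil_sym X6 X1 ks, (bil_sym X3 X2 ks, bil_sym X4 X2 ks, bil_sym X5 X2 ks,
   bil_sym X6 X2 ks), (bil_sym X4 X3 ks, bil_sym X5 X3 ks, bil_sym X6 X3 ks,
   bil_sym X5 X4 ks, bil_sym X6 X4 ks, bil_sym X6 X5 ks)).

Lemma bil_mulmx g (A : 'M[R]_n) u v : bil g (u *m A) v = bil (A *m g) u v.
Proof. by rewrite /bil mulmxA. Qed.

Lemma bilE_sum g u v : bil g u v = \sum_i \sum_j u 0 i * v 0 j * g i j.
Proof.
rewrite /bil mxE exchange_big; apply: eq_bigr => j _ /=.
by rewrite mxE big_distrl /=; apply: eq_bigr => i _; rewrite !mxE; ring.
Qed.

Lemma bil_delta g i j : bil g (delta_mx 0 i) (delta_mx 0 j) = g i j.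
Proof. by rewrite /bil -rowE trmx_delta -colE !mxE. Qed.

Lemma row_bil g u : \row_i bil g u (delta_mx 0 i) = u *m g.
Proof.
by apply/rowP=> i; rewrite mxE /bil trmx_delta -colE mxE.
Qed.

Lemma bil_inj g u v : g \in unitmx ->
  (forall w, bil g u w = bil g v w) -> u = v.
Proof.
move=> gu uv; rewrite -[u](mulmxK gu) -[v](mulmxK gu); congr (_ *m _).
by rewrite -!row_bil; apply/rowP=> i; rewrite !mxE uv.
Qed.

Lemma sharp_unique g u (l : V -> R) : g \in unitmx ->
  (forall v, bil g u v = l v) -> sharp g l = u.
Proof.
move=> gu ul; rewrite /sharp (_ : \row_i _ = u *m g) ?mulmxK//.
by rewrite -row_bil; apply/rowP=> i; rewrite !mxE ul.
Qed.

Lemma sharp_bil g (h : 'M[R]_n) u : sharp g (bil h u) = u *m (h *m invmx g).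
Proof. by rewrite /sharp row_bil mulmxA. Qed.

Lemma traceE (L : V -> V) (A : 'M[R]_n) :
  (forall v, L v = v *m A) -> trace L = \tr A.
Proof.
move=> LA; congr (\tr _); apply/matrixP=> i j; rewrite mxE LA.
by rewrite -rowE mxE.
Qed.

End BilinearForms.

Section CurvatureAlgebra.
Context {R : realType} {n : nat}.
Local Notation V := 'rV[R]_n.
Implicit Types (g h s : 'M[R]_n) (X Y Z W : V).

Lemma ricci_op_bil g s X : ricci_op g (bil s) X = X *m (s *m invmx g).
Proof. exact: sharp_bil. Qed.

Lemma square_bil g s : square g (bil s) = bil (s *m invmx g *m s).
Proof.
by apply/funext=> X; apply/funext=> Y; rewrite /square ricci_op_bil bil_mulmx.
Qed.

Lemma scal_bil g s : scal_of g (bil s) = \tr (s *m invmx g).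
Proof. by apply: traceE => X; rewrite ricci_op_bil. Qed.

(** This is e/2 h/\h + c G with the halves cleared. The scalar e may have either sign, so it cannot
    be absorbed into h. *)
Definition gauss_form g h (e c : R) : V -> V -> V -> V -> R :=
  fun X Y Z W => e * (bil h X W * bil h Y Z - bil h X Z * bil h Y W)
    + c * (bil g X W * bil g Y Z - bil g X Z * bil g Y W).

Lemma gauss_endo g h e c (Rm : V -> V -> V -> V) : g \in unitmx ->
  (forall X Y Z W, bil g (Rm X Y Z) W = gauss_form g h e c X Y Z W) ->
  forall X Y Z, Rm X Y Z =
    e *: (bil h Y Z *: (X *m (h *m invmx g)) - bil h X Z *: (Y *m (h *m invmx g)))
    + c *: (bil g Y Z *: X - bil g X Z *: Y).
Proof.
move=> gu Rmg X Y Z; apply: (bil_inj gu) => W.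
by rewrite Rmg /gauss_form !bilE !bil_mulmx mulmxKV//; ring.
Qed.

Definition gauss_ricci_mx g h (e c : R) : 'M[R]_n :=
  e *: (\tr (h *m invmx g) *: h - h *m invmx g *m h) + (c * (n%:R - 1)) *: g.

Lemma tr_col_row (u v : V) (h : 'M[R]_n) : \tr (h *m v^T *m u) = bil h u v.
Proof. by rewrite mxtrace_mulC /mxtrace big_ord1 mulmxA. Qed.

Lemma gauss_ricci g h e c (Rm : V -> V -> V -> V) : g \in unitmx ->
  (forall X Y Z W, bil g (Rm X Y Z) W = gauss_form g h e c X Y Z W) ->
  ricci_of Rm = bil (gauss_ricci_mx g h e c).
Proof.
move=> gu Rmg; apply/funext=> X; apply/funext=> Y; rewrite /ricci_of.
pose A := h *m invmx g.
(* The matrix of Z |-> R(Z,X)Y acting on rows. A block column times row is a rank-one map such as Z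
   |-> h(Z,Y) XA, and [tr_col_row] gives its trace. *)
rewrite (@traceE _ _ _ (e *: (bil h X Y *: A - h *m Y^T *m (X *m A))
  + c *: (bil g X Y *: 1%:M - g *m Y^T *m X))); last first.
  move=> Z; rewrite (gauss_endo gu Rmg) -/A mulmxDr -!scalemxAr !mulmxBr.
  rewrite -!scalemxAr mulmx1 !mulmxA.
  have sc (k : 'M[R]_n) (U : V) : Z *m k *m Y^T *m U = bil k Z Y *: U.
    by rewrite [Z *m k *m Y^T]mx11_scalar mul_scalar_mx.
  by rewrite !sc -!scalemxAl.
rewrite mxtraceD !mxtraceZ !raddfB /= !mxtraceZ mxtrace1 !tr_col_row.
rewrite bil_mulmx /gauss_ricci_mx !bil_mxE -/A mulrBr; ring.
Qed.

Lemma endoE g (B : V -> V -> V -> V -> R) (L : V -> V -> V -> V) :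
  g \in unitmx -> (forall X Y Z W, bil g (L X Y Z) W = B X Y Z W) ->
  endo g B = L.
Proof.
move=> gu LB; apply/funext=> X; apply/funext=> Y; apply/funext=> Z.
exact: sharp_unique.
Qed.

Lemma gauss_ricci_sym g h e c : g^T = g -> h^T = h ->
  (gauss_ricci_mx g h e c)^T = gauss_ricci_mx g h e c.
Proof.
move=> gs hs; rewrite /gauss_ricci_mx linearD /= !linearZ /= linearB /=.
by rewrite !linearZ /= !trmx_mul trmx_inv gs hs mulmxA.
Qed.

Lemma bil_wedge_opl g (A : V -> V -> R) X Y Z W :
  bil g (wedge_op A X Y Z) W = A Y Z * bil g X W - A X Z * bil g Y W.
Proof. by rewrite /wedge_op !bilE. Qed.

Lemma bil_wedge_opr g (A : V -> V -> R) X Y Z W :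
  bil g W (wedge_op A X Y Z) = A Y Z * bil g W X - A X Z * bil g W Y.
Proof. by rewrite /wedge_op !bilE. Qed.

(** This is R.R = Q(S,R) - (n-2) c Q(g,C), since (n-2) C differs from (n-2) R - g/\S by a multiple
    of G and Q(g,G) = 0. The scalar tr(h g^-1) contained in S cancels because Q(h, h/\h) = 0 and
    Q(h,G) = -Q(g, g/\h). *)
Lemma gauss_semisymmetry g h e c (Rm : V -> V -> V -> V)
    (s := gauss_ricci_mx g h e c) (B := gauss_form g h e c)
    (D := wedge (bil g) (bil s)) X1 X2 X3 X4 X Y :
  g \in unitmx -> g^T = g -> h^T = h ->
  (forall X Y Z W, bil g (Rm X Y Z) W = B X Y Z W) ->
  derivation (Rm X Y) B X1 X2 X3 X4 =
  Q (bil s) B X1 X2 X3 X4 X Y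
  - c * ((n%:R - 2) * Q (bil g) B X1 X2 X3 X4 X Y
         - Q (bil g) D X1 X2 X3 X4 X Y).
Proof.
move=> gu gs hs RmB; pose q := h *m invmx g *m h.
have qs : q^T = q by rewrite /q !trmx_mul trmx_inv gs hs mulmxA.
have sE U W : bil s U W = e * (\tr (h *m invmx g) * bil h U W - bil q U W)
    + c * (n%:R - 1) * bil g U W.
  by rewrite /s /gauss_ricci_mx !bil_mxE.
have Rgr Z W : bil g W (Rm X Y Z) = B X Y Z W by rewrite bil_sym// RmB.
have Rh Z W : bil h (Rm X Y Z) W =
    e * (bil h Y Z * bil q X W - bil h X Z * bil q Y W)
    + c * (bil g Y Z * bil h X W - bil g X Z * bil h Y W).
  by rewrite (gauss_endo gu RmB) !bilE !bil_mulmx.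
have Rhr Z W : bil h W (Rm X Y Z) = bil h (Rm X Y Z) W by rewrite bil_sym.
rewrite /Q /D /derivation /B /gauss_form /wedge !(Rhr, Rgr, Rh, RmB).
rewrite /B /gauss_form !bil_wedge_opl !bil_wedge_opr !sE.
rewrite !(bil_sort6 X1 X2 X3 X4 X Y gs) !(bil_sort6 X1 X2 X3 X4 X Y hs).
rewrite !(bil_sort6 X1 X2 X3 X4 X Y qs).
ring.
Qed.

(* The difference R - C when b = 1/(n-2) and k = kappa/((n-2)(n-1)). *)
Definition weyl_defect g s (b k : R) : V -> V -> V -> V -> R :=
  fun X1 X2 X3 X4 => b * wedge (bil g) (bil s) X1 X2 X3 X4
    - k * Gtensor g X1 X2 X3 X4.

Definition weyl_defect_op g s (b k : R) : V -> V -> V -> V := fun X Y Z =>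
  b *: (bil s Y Z *: X + bil g Y Z *: (X *m (s *m invmx g))
        - bil s X Z *: Y - bil g X Z *: (Y *m (s *m invmx g)))
  - k *: (bil g Y Z *: X - bil g X Z *: Y).

Lemma bil_weyl_defect_op g s b k X Y Z W : g \in unitmx ->
  bil g (weyl_defect_op g s b k X Y Z) W = weyl_defect g s b k X Y Z W.
Proof.
move=> gu; rewrite /weyl_defect_op /weyl_defect /Gtensor /wedge.
by rewrite !bilE !bil_mulmx mulmxKV//; field.
Qed.

(** For b = 1/(n-2) one has 1 + b = (n-1)/(n-2), hence k (1+b) = kappa/(n-2)^2 when k =
    kappa/((n-2)(n-1)). The last three terms are then (n-2)^-2 times Q(g, -) of the tensor in the
    theorem. *)
Lemma weyl_defect_self g s b k X1 X2 X3 X4 X Y :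
  g \in unitmx -> g^T = g -> s^T = s ->
  derivation (weyl_defect_op g s b k X Y) (weyl_defect g s b k) X1 X2 X3 X4 =
  Q (bil s) (weyl_defect g s b k) X1 X2 X3 X4 X Y
  + b / 2 * Q (bil g) (wedge (bil s) (bil s)) X1 X2 X3 X4 X Y
  - k * (1 + b) * Q (bil g) (wedge (bil g) (bil s)) X1 X2 X3 X4 X Y
  + b ^+ 2 * Q (bil g) (wedge (bil g) (square g (bil s))) X1 X2 X3 X4 X Y.
Proof.
move=> gu gs ss; rewrite square_bil; set q := s *m invmx g *m s.
have qs : q^T = q by rewrite /q !trmx_mul trmx_inv gs ss mulmxA.
pose L := weyl_defect_op g s b k X Y.
have Lg Z W : bil g (L Z) W = weyl_defect g s b k X Y Z W.
  exact: bil_weyl_defect_op.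
have Lgr Z W : bil g W (L Z) = weyl_defect g s b k X Y Z W by rewrite bil_sym.
have Ls Z W : bil s (L Z) W =
    b * (bil s Y Z * bil s X W + bil g Y Z * bil q X W
         - bil s X Z * bil s Y W - bil g X Z * bil q Y W)
    - k * (bil g Y Z * bil s X W - bil g X Z * bil s Y W).
  by rewrite /L /weyl_defect_op !bilE !bil_mulmx.
have Lsr Z W : bil s W (L Z) = bil s (L Z) W by rewrite bil_sym.
rewrite /Q /derivation -/L /weyl_defect /Gtensor /wedge.
rewrite !(Lsr, Lgr, Ls, Lg) /weyl_defect /Gtensor /wedge.
rewrite !bil_wedge_opl !bil_wedge_opr.
rewrite !(bil_sort6 X1 X2 X3 X4 X Y gs) !(bil_sort6 X1 X2 X3 X4 X Y ss).
rewrite !(bil_sort6 X1 X2 X3 X4 X Y qs).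
by field.
Qed.

Definition multiadditive (T : V -> V -> V -> V -> R) : Prop :=
  forall U U' X Y Z,
  [/\ T (U - U') X Y Z = T U X Y Z - T U' X Y Z,
      T X (U - U') Y Z = T X U Y Z - T X U' Y Z,
      T X Y (U - U') Z = T X Y U Z - T X Y U' Z &
      T X Y Z (U - U') = T X Y Z U - T X Y Z U'].

(** By bilinearity of the action both sides are 2 B.B - B.D - D.B. Additivity in the operator comes
    from that of the tensor, since the operator acts inside its slots. *)
Lemma derivation_polarization (B D : V -> V -> V -> V -> R) (LB LD : V -> V)
    X1 X2 X3 X4 : multiadditive B -> multiadditive D ->
  let C Y1 Y2 Y3 Y4 := B Y1 Y2 Y3 Y4 - D Y1 Y2 Y3 Y4 in
  let LC Z := LB Z - LD Z in
  derivation LC B X1 X2 X3 X4 + derivation LB C X1 X2 X3 X4 =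
  derivation LC C X1 X2 X3 X4
  + (derivation LB B X1 X2 X3 X4 - derivation LD D X1 X2 X3 X4).
Proof.
move=> Ba Da C LC; rewrite /derivation /C /LC.
have B1 U U' X Y Z : B (U - U') X Y Z = B U X Y Z - B U' X Y Z.
  by have [-> _ _ _] := Ba U U' X Y Z.
have B2 U U' X Y Z : B X (U - U') Y Z = B X U Y Z - B X U' Y Z.
  by have [_ ->] := Ba U U' X Y Z.
have B3 U U' X Y Z : B X Y (U - U') Z = B X Y U Z - B X Y U' Z.
  by have [_ _ ->] := Ba U U' X Y Z.
have B4 U U' X Y Z : B X Y Z (U - U') = B X Y Z U - B X Y Z U'.
  by have [_ _ _ ->] := Ba U U' X Y Z.
have D1 U U' X Y Z : D (U - U') X Y Z = D U X Y Z - D U' X Y Z.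
  by have [-> _ _ _] := Da U U' X Y Z.
have D2 U U' X Y Z : D X (U - U') Y Z = D X U Y Z - D X U' Y Z.
  by have [_ ->] := Da U U' X Y Z.
have D3 U U' X Y Z : D X Y (U - U') Z = D X Y U Z - D X Y U' Z.
  by have [_ _ ->] := Da U U' X Y Z.
have D4 U U' X Y Z : D X Y Z (U - U') = D X Y Z U - D X Y Z U'.
  by have [_ _ _ ->] := Da U U' X Y Z.
rewrite !(B1, B2, B3, B4, D1, D2, D3, D4); ring.
Qed.

Lemma gauss_form_multiadditive g h e c : multiadditive (gauss_form g h e c).
Proof. by move=> U U' X Y Z; split; rewrite /gauss_form !bilE; ring. Qed.

Lemma weyl_defect_multiadditive g s b k : multiadditive (weyl_defect g s b k).
Proof.
by move=> U U' X Y Z; split; rewrite /weyl_defect /Gtensor /wedge !bilE; field.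
Qed.

Lemma gauss_weyl_identity g h e c (Rm : V -> V -> V -> V)
    (B := fun X1 X2 X3 X4 => bil g (Rm X1 X2 X3) X4) (S := ricci_of Rm)
    (C := weyl_of g B S) X1 X2 X3 X4 X Y :
  (2 < n)%N -> g \in unitmx -> g^T = g -> h^T = h ->
  (forall X1 X2 X3 X4, B X1 X2 X3 X4 = gauss_form g h e c X1 X2 X3 X4) ->
  dot g C B X1 X2 X3 X4 X Y + dot g B C X1 X2 X3 X4 X Y =
  Q S C X1 X2 X3 X4 X Y - (n%:R - 2) * c * Q (bil g) C X1 X2 X3 X4 X Y
  + dot g C C X1 X2 X3 X4 X Y
  - ((n%:R - 2) ^+ 2)^-1 *
    Q (bil g) (fun X1 X2 X3 X4 => (n%:R - 2) / 2 * wedge S S X1 X2 X3 X4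
       - scal_of g S * wedge (bil g) S X1 X2 X3 X4
       + wedge (bil g) (square g S) X1 X2 X3 X4) X1 X2 X3 X4 X Y.
Proof.
move=> n2 gu gs hs BE.
have {}BE : B = gauss_form g h e c.
  by do 4!apply/funext=> ?; rewrite BE.
have RB : forall X Y Z W, bil g (Rm X Y Z) W = gauss_form g h e c X Y Z W.
  by move=> *; rewrite -BE.
pose s := gauss_ricci_mx g h e c.
have ss : s^T = s by exact: gauss_ricci_sym.
have SE : S = bil s by exact: gauss_ricci.
have m1 : (n%:R - 1 : R) != 0.
  by rewrite subr_eq0 pnatr_eq1; case: n n2 => [|[]].
have m2 : (n%:R - 2 : R) != 0.
  by rewrite subr_eq0 eqr_nat; case: n n2 => [|[|[]]].
set kp := scal_of g S.
pose b := (n%:R - 2 : R)^-1; pose k := kp / ((n%:R - 2) * (n%:R - 1)).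
pose D := weyl_defect g s b k.
have CE : C = fun Y1 Y2 Y3 Y4 => gauss_form g h e c Y1 Y2 Y3 Y4 - D Y1 Y2 Y3 Y4.
  do 4!apply/funext=> ?; rewrite /C /weyl_of BE /D /weyl_defect -/kp -/b -/k SE.
  ring.
have LB : endo g B = Rm by apply: endoE.
have LC : endo g C = fun X Y Z => Rm X Y Z - weyl_defect_op g s b k X Y Z.
  apply: endoE => // *; rewrite bilDl bilNl bil_weyl_defect_op// CE.
  congr (_ - _).
  by rewrite RB.
rewrite /dot LB LC CE BE.
have := derivation_polarization (Rm X Y) (weyl_defect_op g s b k X Y)
  X1 X2 X3 X4 (@gauss_form_multiadditive g h e c)
  (@weyl_defect_multiadditive g s b k).
move=> /= ->; rewrite (gauss_semisymmetry _ _ _ _ _ _ gu gs hs RB).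
rewrite (weyl_defect_self _ _ _ _ _ _ _ _ gu gs ss) SE -/s.
rewrite /Q /D /weyl_defect /derivation.
rewrite /k /b -/s; set wg := wedge (bil g); set wss := wedge (bil s) (bil s).
(* Q(g,G) = 0, because [wedge_op (bil g) X Y] is skew with respect to g. *)
have G0 Y1 Y2 Y3 Y4 :
    derivation (wedge_op (bil g) X Y) (Gtensor g) Y1 Y2 Y3 Y4 = 0.
  rewrite /derivation /Gtensor /wedge /wedge_op !bilE.
  rewrite ?(bil_sym Y2 Y1 gs) ?(bil_sym Y3 Y1 gs) ?(bil_sym Y4 Y1 gs).
  rewrite !(bil_sym X Y1 gs) !(bil_sym X Y2 gs) !(bil_sym X Y3 gs).
  rewrite !(bil_sym X Y4 gs) !(bil_sym Y Y1 gs) !(bil_sym Y Y2 gs).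
  rewrite !(bil_sym Y Y3 gs) !(bil_sym Y Y4 gs).
  rewrite ?(bil_sym Y3 Y2 gs) ?(bil_sym Y4 Y2 gs) ?(bil_sym Y4 Y3 gs).
  by field.
(* To [field] the four values of G in Q(g,G) are unrelated atoms, so the relation is solved for the
   first of them and substituted. *)
have := G0 X1 X2 X3 X4; rewrite /derivation => /eqP.
rewrite oppr_eq0 !addr_eq0 => /eqP.
move=> /(canRL (addrK _)) /(canRL (addrK _)) ->.
by field; rewrite m1 m2.
Qed.

(** Let T = S - alpha g, of rank one, and let t be its g-trace. Then T/\T = 0 and T g^-1 T = t T, so
    S^2 = alpha^2 g + (2 alpha + t) T and kappa = n alpha + t. The coefficient of g/\T is (n-2)
    alpha - (n alpha + t) + (2 alpha + t) = 0, which leaves a multiple of g/\g. *)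
Lemma rank1_quasi_einstein g s (al : R) X1 X2 X3 X4 X Y :
  g \in unitmx -> g^T = g -> \rank (s - al *: g) = 1%N ->
  Q (bil g) (fun X1 X2 X3 X4 =>
    (n%:R - 2) / 2 * wedge (bil s) (bil s) X1 X2 X3 X4
    - scal_of g (bil s) * wedge (bil g) (bil s) X1 X2 X3 X4
    + wedge (bil g) (square g (bil s)) X1 X2 X3 X4) X1 X2 X3 X4 X Y = 0.
Proof.
move=> gu gs rk; pose T := s - al *: g.
have [u [v Tuv]] : exists u v : V, T = u^T *m v.
  have := mulmx_base T; move: (col_base T) (row_base T); rewrite rk => u v <-.
  by exists u^T, v; rewrite trmxK.
have sE : s = al *: g + u^T *m v by rewrite -Tuv /T addrC subrK.
pose t := (v *m invmx g *m u^T) 0 0.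
have TT : u^T *m v *m invmx g *m (u^T *m v) = t *: (u^T *m v).
  rewrite -!mulmxA (mulmxA v) (mulmxA _ u^T) [v *m invmx g *m u^T]mx11_scalar.
  by rewrite mul_scalar_mx -scalemxAr.
rewrite square_bil scal_bil.
have -> : s *m invmx g *m s = al ^+ 2 *: g + (2 * al + t) *: (u^T *m v).
  rewrite sE !mulmxDl !mulmxDr -!scalemxAl -!scalemxAr mulmxV// !mul1mx.
  rewrite TT mulmxKV//; move: (u^T *m v) => P.
  by apply/matrixP=> i j; rewrite !mxE; ring.
have -> : \tr (s *m invmx g) = n%:R * al + t.
  rewrite sE mulmxDl -scalemxAl mulmxV// mxtraceD mxtraceZ mxtrace1 mulrC.
  by rewrite -mulmxA mxtrace_mulC /mxtrace big_ord1.
have bT Z W : bil (u^T *m v) Z W = (Z *m u^T) 0 0 * (v *m W^T) 0 0.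
  by rewrite /bil mulmxA -[_ *m v *m _]mulmxA mxE big_ord1.
rewrite /Q /derivation /wedge !bil_wedge_opl !bil_wedge_opr sE !bil_mxE !bT.
rewrite (bil_sym X2 X gs) (bil_sym X2 Y gs) (bil_sym X1 X gs) (bil_sym X1 Y gs).
by field.
Qed.

End CurvatureAlgebra.

(** * Differential calculus *)

Section SymmetryOfSecondDerivatives.
Context {R : realType} {V : normedModType R}.
Implicit Types (f : V -> R) (x u v : V) (A : set V).

Lemma distr_lt2 (p q r r' e : R) : r = r' -> `|p - r| < e -> `|q - r'| < e ->
  `|p - q| < e + e.
Proof.
by move=> <- pr qr; rewrite (le_lt_trans (ler_distD r _ _))// ltrD// distrC.
Qed.

Lemma is_derive_line f x u (s : R) : derivable f (x + s *: u) u ->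
  is_derive s 1 (fun t : R => f (x + t *: u)) ('D_u f (x + s *: u)).
Proof.
move=> fu.
have E : (fun h : R => h^-1 *: (((fun t : R => f (x + t *: u)) \o shift s)
    (h *: (1 : R)) - f (x + s *: u))) =
  (fun h : R => h^-1 *: ((f \o shift (x + s *: u)) (h *: u) - f (x + s *: u))).
  apply/funext=> h /=; congr (_ *: (f _ - _)).
  by rewrite [h%:A]mulr1 scalerDl addrCA.
by split; rewrite /derivable /derive E.
Qed.

Lemma is_derive_translate f x u w : derivable f (x + w) u ->
  is_derive x u (fun y => f (y + w)) ('D_u f (x + w)).
Proof.
move=> fu.
have E : (fun h : R => h^-1 *: (((fun y => f (y + w)) \o shift x)
    (h *: u) - f (x + w))) =
  (fun h : R => h^-1 *: ((f \o shift (x + w)) (h *: u) - f (x + w))).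
  by apply/funext=> h /=; rewrite addrA.
by split; rewrite /derivable /derive E.
Qed.

Lemma MVT_line f x u (t : R) : 0 < t ->
  (forall s, 0 <= s <= t -> derivable f (x + s *: u) u) ->
  exists2 s, 0 <= s <= t & f (x + t *: u) - f x = t * 'D_u f (x + s *: u).
Proof.
move=> t0 fu.
have [s||s st] := @MVT R (fun s : R => f (x + s *: u))
    (fun s : R => 'D_u f (x + s *: u)) 0 t t0.
- by rewrite in_itv/= => /andP[s0 st]; apply/is_derive_line/fu; rewrite !ltW.
- apply: derivable_within_continuous => s; rewrite in_itv/= => st.
  exact/ex_derive/is_derive_line/fu.
rewrite scale0r addr0 subr0 mulrC => ->; exists s => //.
by move: st; rewrite in_itv/= => /andP[s0 st]; rewrite !ltW.
Qed.

(** The mean value theorem is applied along u to y |-> f(y + t v) - f(y), then along v to 'D_u f.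
    The difference on the left is symmetric in u and v, which [schwarz] exploits. *)
Lemma second_difference f x u v (t : R) A : 0 < t ->
  (forall a b, 0 <= a <= t -> 0 <= b <= t -> A (x + a *: u + b *: v)) ->
  (forall y, A y -> derivable f y u /\ derivable ('D_u f) y v) ->
  exists a b, [/\ 0 <= a <= t, 0 <= b <= t &
    f (x + t *: u + t *: v) - f (x + t *: u) - f (x + t *: v) + f x
    = t * (t * 'D_v ('D_u f) (x + a *: u + b *: v))].
Proof.
move=> t0 Ax fA; have tt : 0 <= t <= t by rewrite lexx ltW.
have z0 : 0 <= (0 : R) <= t by rewrite lexx ltW.
have fu a : 0 <= a <= t -> is_derive (x + a *: u) u
    (fun y => f (y + t *: v) - f y)
    ('D_u f (x + a *: u + t *: v) - 'D_u f (x + a *: u)).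
  move=> at_; apply: is_deriveB.
    by apply: is_derive_translate; exact: (fA _ (Ax _ _ at_ tt)).1.
  apply: derivableP; have := (fA _ (Ax _ _ at_ z0)).1.
  by rewrite scale0r addr0.
have [|a at_ /= fa] := @MVT_line (fun y => f (y + t *: v) - f y) x u t t0.
  by move=> s /fu fs; exact: ex_derive.
have [|b bt fb] := @MVT_line ('D_u f) (x + a *: u) v t t0.
  by move=> s st; exact: (fA _ (Ax _ _ at_ st)).2.
exists a, b; split=> //; rewrite -fb.
rewrite -(@derive_val _ _ _ _ _ _ _ (fu a at_)) -fa.
ring.
Qed.

(** If the two mixed derivatives differed at x, each would stay within half of the gap from its
    value at x on a small parallelogram. The second difference, evaluated in both orders, produces a
    common value of the two there, a contradiction. *)
Lemma schwarz f x u v A : open A -> A x ->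
  (forall y, A y -> derivable f y u /\ derivable f y v) ->
  (forall y, A y -> derivable ('D_u f) y v /\ derivable ('D_v f) y u) ->
  {for x, continuous ('D_v ('D_u f))} -> {for x, continuous ('D_u ('D_v f))} ->
  'D_v ('D_u f) x = 'D_u ('D_v f) x.
Proof.
move=> oA Ax f1 f2 c1 c2; apply/eqP/negPn/negP => neq.
set F1 := 'D_v ('D_u f) in c1 neq; set F2 := 'D_u ('D_v f) in c2 neq.
pose e := `|F1 x - F2 x| / 2.
have e0 : 0 < e by rewrite divr_gt0// normr_gt0 subr_eq0.
have nA : \forall y \near x, A y by exact: open_nbhs_nbhs.
have n1 : \forall y \near x, `|F1 x - F1 y| < e.
  by move/(@cvgrPdist_lt R R): c1; apply.
have n2 : \forall y \near x, `|F2 x - F2 y| < e.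
  by move/(@cvgrPdist_lt R R): c2; apply.
have : \forall y \near x, [/\ A y, `|F1 x - F1 y| < e & `|F2 x - F2 y| < e].
  exact: filterS3 nA n1 n2.
move/nbhs_ballP => [d /= d0 xd].
(* The summand 1 keeps M positive even when u = v = 0; the displacement has norm at most t M =
   d/2. *)
pose M := `|u| + `|v| + 1; have M0 : 0 < M by rewrite ltr_wpDl// addr_ge0.
pose t := d / (2 * M); have t0 : 0 < t by rewrite divr_gt0// mulr_gt0.
have inball a b : 0 <= a <= t -> 0 <= b <= t -> ball x d (x + a *: u + b *: v).
  move=> /andP[a0 at_] /andP[b0 bt]; rewrite -ball_normE /= -addrA opprD addrA.
  rewrite subrr add0r normrN (le_lt_trans (ler_normD _ _))// !normrZ.
  rewrite !ger0_norm//; have tM : t * M = d / 2.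
    by rewrite /t; field; apply: lt0r_neq0.
  have : a * `|u| + b * `|v| <= t * M.
    by rewrite /M 2!mulrDr -[leLHS]addr0 !lerD// ?ler_wpM2r// mulr1 ltW.
  rewrite tM => /le_lt_trans; apply.
  by rewrite ltr_pdivrMr// mulr2n mulrDr mulr1 ltrDl.
have {}xd a b : 0 <= a <= t -> 0 <= b <= t -> [/\ A (x + a *: u + b *: v),
    `|F1 x - F1 (x + a *: u + b *: v)| < e &
    `|F2 x - F2 (x + a *: u + b *: v)| < e].
  by move=> at_ bt; exact/xd/inball.
have [a [b [at_ bt ab]]] := @second_difference f x u v t A t0
  (fun a b at_ bt => let: And3 Axy _ _ := xd a b at_ bt in Axy)
  (fun y Ay => conj (f1 y Ay).1 (f2 y Ay).1).
have Avu a' b' : 0 <= a' <= t -> 0 <= b' <= t -> A (x + a' *: v + b' *: u).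
  by move=> at' bt'; rewrite addrAC; have [] := xd b' a' bt' at'.
have [b' [a' [bt' at' ab']]] := @second_difference f x v u t A t0 Avu
  (fun y Ay => conj (f1 y Ay).2 (f2 y Ay).2).
have E : F1 (x + a *: u + b *: v) = F2 (x + a' *: u + b' *: v).
  apply: (mulfI (lt0r_neq0 t0)); apply: (mulfI (lt0r_neq0 t0)).
  apply: etrans (esym ab) _; rewrite [x + a' *: u + _]addrAC.
  apply: etrans _ ab'; rewrite [x + t *: u + _]addrAC; ring.
have [_ xab _] := xd a b at_ bt; have [_ _ xab'] := xd a' b' at' bt'.
by have := distr_lt2 E xab xab'; rewrite /e -splitr ltxx.
Qed.

End SymmetryOfSecondDerivatives.

Section DerivativeRules.
Context {R : realType} {V : normedModType R}.
Implicit Types (x u v : V) (A : set V).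

Lemma is_derive_mul (f g : V -> R) x u df dg :
  is_derive x u f df -> is_derive x u g dg ->
  is_derive x u (fun y => f y * g y) (df * g x + f x * dg).
Proof.
move=> fd gd; apply: is_derive_eq (is_deriveM fd gd) _.
by rewrite addrC [in RHS](mulrC df).
Qed.

Lemma is_derive_bigsum n (f : 'I_n -> V -> R) x u df :
  (forall i, is_derive x u (f i) (df i)) ->
  is_derive x u (fun y => \sum_i f i y) (\sum_i df i).
Proof.
move=> fd; have := is_derive_sum fd.
rewrite (_ : \sum_i f i = fun y => \sum_i f i y)//.
by apply/funext => y; rewrite fct_sumE.
Qed.

Lemma derivable_mul (f g : V -> R) x u : derivable f x u -> derivable g x u ->
  derivable (fun y => f y * g y) x u.
Proof.
by move=> /derivableP fd /derivableP gd; have [] := is_derive_mul fd gd.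
Qed.

Lemma derivable_bigprod (I : Type) (r : seq I) (f : I -> V -> R) x u :
  (forall i, derivable (f i) x u) ->
  derivable (fun y => \prod_(i <- r) f i y) x u.
Proof.
move=> fd; elim: r => [|i r IH].
  under eq_fun do rewrite big_nil; exact: derivable_cst.
by under eq_fun do rewrite big_cons; apply: derivable_mul (fd i) IH.
Qed.

Lemma derivable_bigsum (I : Type) (r : seq I) (f : I -> V -> R) x u :
  (forall i, derivable (f i) x u) ->
  derivable (fun y => \sum_(i <- r) f i y) x u.
Proof.
move=> fd; elim: r => [|i r IH].
  under eq_fun do rewrite big_nil; exact: derivable_cst.
by under eq_fun do rewrite big_cons; apply: derivableD (fd i) IH.
Qed.

Lemma derivable_det n (A : V -> 'M[R]_n) x u :
  (forall i j, derivable (fun y => A y i j) x u) ->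
  derivable (fun y => \det (A y)) x u.
Proof.
move=> Ad; apply: derivable_bigsum => s.
by apply: derivable_mul; [exact: derivable_cst|exact: derivable_bigprod].
Qed.

(** Cramer's rule. It describes [invmx] only at invertible matrices, whence the condition on a whole
    neighbourhood. *)
Lemma derivable_invmx n (A : V -> 'M[R]_n) x u :
  (\forall y \near x, A y \in unitmx) ->
  (forall i j, derivable (fun y => A y i j) x u) ->
  forall i j, derivable (fun y => invmx (A y) i j) x u.
Proof.
move=> Au Ad i j; have Ax := nbhs_singleton Au.
apply: (@near_eq_derivable _ _ _
  (fun y => (\det (A y))^-1 * cofactor (A y) j i)).
  by apply: filterS Au => y Ay; rewrite /invmx Ay !mxE.
apply: derivable_mul.
  by apply: derivableV; [rewrite -unitfE -unitmxE|exact: derivable_det].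
apply: derivable_mul; first exact: derivable_cst.
apply: derivable_det => k l.
by under eq_fun do rewrite !mxE; exact: Ad.
Qed.

Lemma derive_is_linear (W : normedModType R) (f : V -> W) x :
  differentiable f x ->
  forall a u v, 'D_(a *: u + v) f x = a *: 'D_u f x + 'D_v f x.
Proof. by move=> fx a u v; rewrite !deriveE// linearP. Qed.

Lemma is_derive_chain (W : normedModType R) (F : V -> W) (f : W -> R) x u :
  differentiable F x -> differentiable f (F x) ->
  is_derive x u (f \o F) ('D_('D_u F x) f (F x)).
Proof.
move=> Fx fx; have FfF := differentiable_comp Fx fx.
split; first exact: diff_derivable.
by rewrite !deriveE// diff_comp.
Qed.

Lemma is_derive_coord m n (F : V -> 'M[R]_(m, n)) x u dF i j :
  is_derive x u F dF -> is_derive x u (fun y => F y i j) (dF i j).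
Proof.
move=> [Fd <-]; rewrite derive_mx// mxE; apply: derivableP.
by move/derivable_mxP : Fd.
Qed.

Lemma is_derive_mx m n (F : V -> 'M[R]_(m, n)) x u (dF : 'M[R]_(m, n)) :
  (forall i j, is_derive x u (fun y => F y i j) (dF i j)) -> is_derive x u F dF.
Proof.
move=> Fd; have Fdb : derivable F x u.
  by apply/derivable_mxP => i j; have [] := Fd i j.
split=> //; rewrite derive_mx//; apply/matrixP=> i j; rewrite mxE.
by have [] := Fd i j.
Qed.

Lemma smooth_on_differentiable (W : normedModType R) A (f : V -> W) x :
  smooth_on A f -> A x -> differentiable f x.
Proof. by move=> /(_ 1%N)[+ _]; apply. Qed.

Lemma smooth_on_derive (W : normedModType R) A (f : V -> W) u :
  smooth_on A f -> smooth_on A ('D_u f).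
Proof. by move=> fs k; have [_ /(_ u)] := fs k.+1. Qed.

Lemma smooth_on_derivable (W : normedModType R) A (f : V -> W) x u :
  smooth_on A f -> A x -> derivable f x u.
Proof. by move=> fs Ax; apply/diff_derivable/(smooth_on_differentiable fs). Qed.

Lemma smooth_on_schwarz A (f : V -> R) x u v : open A -> smooth_on A f -> A x ->
  'D_u ('D_v f) x = 'D_v ('D_u f) x.
Proof.
move=> oA fs Ax; have fus := smooth_on_derive u fs.
have fvs := smooth_on_derive v fs.
apply: (schwarz oA Ax) => [y Ay|y Ay||].
- by split; exact: smooth_on_derivable fs _.
- by split; [exact: smooth_on_derivable fvs _|exact: smooth_on_derivable fus _].
- exact: (smooth_on_derive u fvs 0%N).
- exact: (smooth_on_derive v fus 0%N).
Qed.

Lemma continuous_coord m n (G : V -> 'M[R]_(m, n)) x i j :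
  {for x, continuous G} -> {for x, continuous (fun y => G y i j)}.
Proof.
move=> Gx; apply: (@continuous_comp _ _ _ G (fun M : 'M[R]_(m, n) => M i j)) => //.
exact: coord_continuous.
Qed.

Lemma near_eq_continuous (f g : V -> R) x : (\forall y \near x, f y = g y) ->
  {for x, continuous f} -> {for x, continuous g}.
Proof.
move=> fg fx; rewrite /prop_for /continuous_at -(nbhs_singleton fg).
exact: cvg_trans (near_eq_cvg fg) fx.
Qed.

(** The scalar case is applied to each entry. Derivatives of an entry are known to be entries of
    derivatives only on A, so second derivatives are transferred by local equality. *)
Lemma smooth_on_schwarz_mx m n A (F : V -> 'M[R]_(m, n)) x u v :
  open A -> smooth_on A F -> A x -> 'D_u ('D_v F) x = 'D_v ('D_u F) x.
Proof.
move=> oA Fs Ax; have Fus := smooth_on_derive u Fs.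
have Fvs := smooth_on_derive v Fs.
have nA y : A y -> \forall z \near y, A z by move=> Ay; exact: open_nbhs_nbhs.
have coord (G : V -> 'M[R]_(m, n)) i j w y : smooth_on A G -> A y ->
    'D_w (fun z => G z i j) y = 'D_w G y i j.
  move=> Gs Ay; apply: derive_val; apply: is_derive_coord.
  by apply: derivableP; exact: smooth_on_derivable Gs _.
have coord2 w w' i j y : A y -> is_derive y w ('D_w' (fun z => F z i j))
    ('D_w ('D_w' F) y i j).
  move=> Ay; apply: (@near_eq_is_derive _ _ _ (fun z => 'D_w' F z i j)).
    by near=> z; rewrite coord//; near: z; exact: nA.
  apply: is_derive_coord; apply: derivableP.
  exact: smooth_on_derivable (smooth_on_derive w' Fs) _.
have val2 w w' i j y : A y ->
    'D_w ('D_w' (fun z => F z i j)) y = 'D_w ('D_w' F) y i j.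
  by move=> Ay; have [_] := coord2 w w' i j y Ay.
apply/matrixP=> i j.
apply: etrans (esym (val2 u v i j x Ax)) _.
apply: etrans _ (val2 v u i j x Ax).
have cc w w' : {for x, continuous ('D_w ('D_w' (fun z => F z i j)))}.
  have c0 : {for x, continuous (fun z => 'D_w ('D_w' F) z i j)}.
    apply: continuous_coord.
    exact: (smooth_on_derive w (smooth_on_derive w' Fs) 0%N).
  apply: near_eq_continuous c0; near=> z.
  have Az : A z by near: z; exact: nA.
  by rewrite val2.
apply: (schwarz oA Ax) => [y Ay|y Ay||//].
- by split; move: (i) (j); apply/derivable_mxP; exact: smooth_on_derivable Fs _.
- by split; [have [] := coord2 u v i j y Ay|have [] := coord2 v u i j y Ay].
- exact: cc.
Unshelve. all: by end_near. Qed.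

End DerivativeRules.

(** * Christoffel symbols and the curvature of a metric in a chart *)

Section TrilinearForms.
Context {R : realType} {n : nat}.
Implicit Types (E : 'I_n -> 'I_n -> 'I_n -> R) (u v w : 'rV[R]_n).

(** With [dgram] as coefficients this is D_u g(v,w). Writing it as a polynomial in components allows
    it to be differentiated when the direction u itself varies, as 'D_v F does along an
    immersion. *)
Definition tri E u v w : R :=
  \sum_i \sum_j \sum_k u 0 i * v 0 j * w 0 k * E i j k.

Lemma tri_lin1 E a u u' v w :
  tri E (a *: u + u') v w = a * tri E u v w + tri E u' v w.
Proof.
rewrite /tri; do 3!(rewrite mulr_sumr -big_split; apply: eq_bigr => ? _ /=).
rewrite !mxE; ring.
Qed.

Lemma tri_lin2 E a u v v' w :
  tri E u (a *: v + v') w = a * tri E u v w + tri E u v' w.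
Proof.
rewrite /tri; do 3!(rewrite mulr_sumr -big_split; apply: eq_bigr => ? _ /=).
rewrite !mxE; ring.
Qed.

Lemma tri_lin3 E a u v w w' :
  tri E u v (a *: w + w') = a * tri E u v w + tri E u v w'.
Proof.
rewrite /tri; do 3!(rewrite mulr_sumr -big_split; apply: eq_bigr => ? _ /=).
rewrite !mxE; ring.
Qed.

Lemma tri0l E v w : tri E 0 v w = 0.
Proof. by rewrite /tri; do 3!apply: big1 => ? _; rewrite mxE !mul0r. Qed.

Lemma tri0m E u w : tri E u 0 w = 0.
Proof. by rewrite /tri; do 3!apply: big1 => ? _; rewrite mxE mulr0 !mul0r. Qed.

Lemma tri0r E u v : tri E u v 0 = 0.
Proof. by rewrite /tri; do 3!apply: big1 => ? _; rewrite mxE mulr0 mul0r. Qed.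

Lemma tri_sym23 E u v w : (forall i j k, E i j k = E i k j) ->
  tri E u v w = tri E u w v.
Proof.
move=> Es; rewrite /tri; apply: eq_bigr => i _; rewrite exchange_big /=.
by apply: eq_bigr => k _; apply: eq_bigr => j _; rewrite Es; ring.
Qed.

Lemma tri_bil E u v w : tri E u v w =
  bil (\matrix_(j, k) \sum_i u 0 i * E i j k) v w.
Proof.
rewrite bilE_sum /tri exchange_big /=; apply: eq_bigr => j _.
rewrite exchange_big /=; apply: eq_bigr => k _; rewrite mxE mulr_sumr.
by apply: eq_bigr => i _; ring.
Qed.

Lemma eq_tri E E' u u' v w :
  (forall j k, \sum_i u 0 i * E i j k = \sum_i u' 0 i * E' i j k) ->
  tri E u v w = tri E' u' v w.
Proof.
move=> EE'; rewrite !tri_bil; congr (bil _ v w).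
by apply/matrixP=> j k; rewrite !mxE.
Qed.

Lemma lin_delta (l : 'rV[R]_n -> R) :
  (forall a u v, l (a *: u + v) = a * l u + l v) ->
  forall w, l w = \sum_i w 0 i * l (delta_mx 0 i).
Proof.
move=> ll w; have l0 : l 0 = 0.
  have := ll 1 0 0; rewrite scale1r addr0 mul1r => e.
  by apply: (addrI (l 0)); rewrite addr0 -e.
rewrite {1}[w]row_sum_delta; elim/big_rec2: _ => // i y z _ <-.
by rewrite ll.
Qed.

Lemma bil_sharp g (l : 'rV[R]_n -> R) w : g \in unitmx ->
  (forall a u v, l (a *: u + v) = a * l u + l v) -> bil g (sharp g l) w = l w.
Proof.
move=> gu ll; rewrite /bil /sharp mulmxKV// mxE (lin_delta ll w).
by apply: eq_bigr => i _; rewrite !mxE mulrC.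
Qed.

End TrilinearForms.

Section DerivativesOfForms.
Context {R : realType} {V : normedModType R} {n : nat}.
Implicit Types (x d : V).

Lemma is_derive_tri (E : V -> 'I_n -> 'I_n -> 'I_n -> R) (u v w : V -> 'rV[R]_n)
    x d dE du dv dw :
  (forall i j k, is_derive x d (fun y => E y i j k) (dE i j k)) ->
  is_derive x d u du -> is_derive x d v dv -> is_derive x d w dw ->
  is_derive x d (fun y => tri (E y) (u y) (v y) (w y))
    (tri dE (u x) (v x) (w x) + tri (E x) du (v x) (w x)
     + tri (E x) (u x) dv (w x) + tri (E x) (u x) (v x) dw).
Proof.
move=> Ed ud vd wd; rewrite /tri -!big_split /=.
apply: is_derive_bigsum => i; rewrite -!big_split /=.
apply: is_derive_bigsum => j; rewrite -!big_split /=.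
apply: is_derive_bigsum => k.
apply: is_derive_eq (is_derive_mul (is_derive_mul (is_derive_mul
  (is_derive_coord 0 i ud) (is_derive_coord 0 j vd)) (is_derive_coord 0 k wd))
  (Ed i j k)) _.
ring.
Qed.

Lemma is_derive_bil (G : V -> 'M[R]_n) (u v : V -> 'rV[R]_n) x d dG du dv :
  is_derive x d G dG -> is_derive x d u du -> is_derive x d v dv ->
  is_derive x d (fun y => bil (G y) (u y) (v y))
    (bil dG (u x) (v x) + bil (G x) du (v x) + bil (G x) (u x) dv).
Proof.
move=> Gd ud vd; under eq_fun do rewrite bilE_sum.
rewrite !bilE_sum -!big_split /=.
apply: is_derive_bigsum => i; rewrite -!big_split /=.
apply: is_derive_bigsum => j.
apply: is_derive_eq (is_derive_mul (is_derive_mul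
  (is_derive_coord 0 i ud) (is_derive_coord 0 j vd)) (is_derive_coord i j Gd)) _.
ring.
Qed.

End DerivativesOfForms.

Definition local_metric (R : realType) (n : nat) (A : set 'rV[R]_n)
    (G : 'rV[R]_n -> 'M[R]_n) : Prop :=
  [/\ open A, forall y, A y -> (G y)^T = G y, forall y, A y -> G y \in unitmx &
      forall i j, smooth_on A (fun y => G y i j)].

Section LocalMetric.
Context {R : realType} {n : nat}.
Local Notation V := 'rV[R]_n.
Variables (A : set V) (G : V -> 'M[R]_n).
Hypothesis mG : local_metric A G.
Implicit Types (x y u v w z : V).

Definition dgram y i j k : R := 'D_(delta_mx 0 i) (fun z => G z j k) y.

Definition ddgram x u i j k : R := 'D_u (fun y => dgram y i j k) x.

Definition lower_christoffel y u v w : R :=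
  2^-1 * (tri (dgram y) u v w + tri (dgram y) v u w - tri (dgram y) w u v).

Let oA : open A. Proof. by case: mG. Qed.
Let Gs y : A y -> (G y)^T = G y. Proof. by case: mG => _ /(_ y). Qed.
Let Gu y : A y -> G y \in unitmx. Proof. by case: mG => _ _ /(_ y). Qed.
Let Gd i j : smooth_on A (fun y => G y i j). Proof. by case: mG. Qed.

Let nA x : A x -> \forall y \near x, A y.
Proof. by move=> Ax; exact: open_nbhs_nbhs. Qed.

Lemma derive_gram_entry x u i j : A x ->
  'D_u (fun y => G y i j) x = \sum_k u 0 k * dgram x k i j.
Proof.
move=> Ax; apply: (lin_delta (l := fun u => 'D_u (fun y => G y i j) x)).
move=> a v w; apply: derive_is_linear.
exact: smooth_on_differentiable (Gd i j) Ax.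
Qed.

Lemma is_derive_gram x u : A x ->
  is_derive x u G (\matrix_(i, j) \sum_k u 0 k * dgram x k i j).
Proof.
move=> Ax; apply: is_derive_mx => i j; rewrite mxE -derive_gram_entry//.
by apply: derivableP; exact: smooth_on_derivable (Gd i j) Ax.
Qed.

Lemma derive_gram x u v w : A x ->
  'D_u (fun y => bil (G y) v w) x = tri (dgram x) u v w.
Proof.
move=> Ax; have := is_derive_bil (is_derive_gram u Ax)
  (is_derive_cst v x u) (is_derive_cst w x u).
move=> /(@derive_val _ _ _ _ _ _ _) /= ->.
by rewrite tri_bil bil0l bil0r !addr0.
Qed.

Lemma dgram_sym x i j k : A x -> dgram x i j k = dgram x i k j.
Proof.
move=> Ax; apply: near_eq_derive; near=> y.
have Ay : A y by near: y; exact: nA.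
by rewrite -[in LHS](Gs Ay) mxE.
Unshelve. all: by end_near. Qed.

Lemma is_derive_dgram x u i j k : A x ->
  is_derive x u (fun y => dgram y i j k) (ddgram x u i j k).
Proof.
move=> Ax; apply: derivableP.
exact: smooth_on_derivable (smooth_on_derive _ (Gd j k)) Ax.
Qed.

Lemma differentiable_dgram x i j k : A x ->
  differentiable (fun y => dgram y i j k) x.
Proof.
by move=> Ax; exact: smooth_on_differentiable (smooth_on_derive _ (Gd j k)) Ax.
Qed.

Lemma ddgram_sym x u i j k : A x -> ddgram x u i j k = ddgram x u i k j.
Proof.
move=> Ax; apply: near_eq_derive; near=> y; apply: dgram_sym.
by near: y; exact: nA.
Unshelve. all: by end_near. Qed.

Lemma ddgram_schwarz x u v w z : A x ->
  tri (ddgram x u) v w z = tri (ddgram x v) u w z.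
Proof.
move=> Ax.
have D2 (s t : V) i j : \sum_k t 0 k * ddgram x s k i j =
    'D_s ('D_t (fun y => G y i j)) x.
  apply: esym; apply: derive_val.
  apply: (@near_eq_is_derive _ _ _ (fun y => \sum_k t 0 k * dgram y k i j)).
    by near=> y; rewrite derive_gram_entry//; near: y; exact: nA.
  apply: is_derive_bigsum => k.
  apply: is_derive_eq (is_derive_mul (is_derive_cst (t 0 k) x s)
    (is_derive_dgram s k i j Ax)) _.
  by rewrite mul0r add0r.
apply: eq_tri => i j; apply: etrans (D2 u v i j) _.
apply: etrans _ (esym (D2 v u i j)).
exact: smooth_on_schwarz oA (Gd i j) Ax.
Unshelve. all: by end_near. Qed.

Lemma lower_christoffel_lin1 x a u u' v w :
  lower_christoffel x (a *: u + u') v w =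
  a * lower_christoffel x u v w + lower_christoffel x u' v w.
Proof. by rewrite /lower_christoffel tri_lin1 !tri_lin2; ring. Qed.

Lemma lower_christoffel0 x v w : lower_christoffel x 0 v w = 0.
Proof. by rewrite /lower_christoffel tri0l !tri0m addr0 subrr mulr0. Qed.

Lemma lower_christoffel_lin3 x a u v w w' :
  lower_christoffel x u v (a *: w + w') =
  a * lower_christoffel x u v w + lower_christoffel x u v w'.
Proof. by rewrite /lower_christoffel tri_lin1 !tri_lin3; ring. Qed.

Lemma lower_christoffel_sym x u v w : A x ->
  lower_christoffel x u v w = lower_christoffel x v u w.
Proof.
move=> Ax; rewrite /lower_christoffel (tri_sym23 w u v); first ring.
by move=> *; exact: dgram_sym.
Qed.

(** Metric compatibility: in the sum of the two symbols all Koszul terms but D_u g(v,w) cancel. *)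
Lemma tri_dgramE x u v w : A x ->
  tri (dgram x) u v w = lower_christoffel x u v w + lower_christoffel x u w v.
Proof.
move=> Ax; have s (a b c : V) : tri (dgram x) a b c = tri (dgram x) a c b.
  by apply: tri_sym23 => *; exact: dgram_sym.
rewrite /lower_christoffel (s u w v); by field.
Qed.

Lemma christoffelE x u v : A x ->
  christoffel G x u v = sharp (G x) (lower_christoffel x u v).
Proof.
move=> Ax; congr (sharp _ _); apply/funext=> w.
by rewrite !derive_gram.
Qed.

Lemma bil_christoffel x u v w : A x ->
  bil (G x) (christoffel G x u v) w = lower_christoffel x u v w.
Proof.
move=> Ax; rewrite christoffelE// bil_sharp ?Gu// => a s t.
exact: lower_christoffel_lin3.
Qed.

Lemma christoffel_lin1 x a u u' v : A x ->
  christoffel G x (a *: u + u') v =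
  a *: christoffel G x u v + christoffel G x u' v.
Proof.
move=> Ax; apply: (bil_inj (Gu Ax)) => w; rewrite bilDl bilZl.
have := lower_christoffel_lin1 x a u u' v w.
rewrite -(bil_christoffel (a *: u + u') v w Ax) -(bil_christoffel u v w Ax).
by rewrite -(bil_christoffel u' v w Ax).
Qed.

Lemma christoffel_sym x u v : A x -> christoffel G x u v = christoffel G x v u.
Proof.
move=> Ax; apply: (bil_inj (Gu Ax)) => w.
apply: etrans (bil_christoffel u v w Ax) _.
apply: etrans _ (esym (bil_christoffel v u w Ax)).
exact: lower_christoffel_sym.
Qed.

Definition dlower_christoffel x u v w z : R :=
  2^-1 * (tri (ddgram x u) v w z + tri (ddgram x u) w v z
          - tri (ddgram x u) z v w).

Lemma is_derive_lower_christoffel x u v w z : A x ->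
  is_derive x u (fun y => lower_christoffel y v w z) (dlower_christoffel x u v w z).
Proof.
move=> Ax; have dt (a b c : V) : is_derive x u (fun y => tri (dgram y) a b c)
    (tri (ddgram x u) a b c).
  apply: is_derive_eq (is_derive_tri (fun i j k => is_derive_dgram u i j k Ax)
    (is_derive_cst a x u) (is_derive_cst b x u) (is_derive_cst c x u)) _.
  by rewrite tri0l tri0m tri0r !addr0.
apply: is_derive_eq (is_derive_mul (is_derive_cst _ _ _)
  (is_deriveB (is_deriveD (dt v w z) (dt w v z)) (dt z v w))) _.
by rewrite mul0r add0r.
Qed.

(** The inverse metric is differentiated here, and only existence of the derivative is recorded. *)
Lemma derivable_christoffel x d u v : A x ->
  derivable (fun y => christoffel G y u v) x d.
Proof.
move=> Ax; apply: (@near_eq_derivable _ _ _ (fun y =>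
    (\row_i lower_christoffel y u v (delta_mx 0 i)) *m invmx (G y))).
  by near=> y; rewrite christoffelE//; near: y; exact: nA.
apply/derivable_mxP => i k; under eq_fun do rewrite mxE.
apply: derivable_bigsum => j; apply: derivable_mul.
  under eq_fun do rewrite mxE.
  by have [] := is_derive_lower_christoffel d u v (delta_mx 0 j) Ax.
apply: derivable_invmx => [|i' j'].
  by near=> y; apply: Gu; near: y; exact: nA.
exact: smooth_on_derivable (Gd i' j') Ax.
Unshelve. all: by end_near. Qed.

(* Metric compatibility: g(nabla_u Gam, z) = D_u (g(Gam, z)) - g(Gam, Gam(u, z))
   for Gam = Gam(v, w), which only involves derivatives of scalar functions. *)
Lemma bil_derive_christoffel x u v w z : A x ->
  bil (G x) ('D_u (fun y => christoffel G y v w) x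
             + christoffel G x u (christoffel G x v w)) z =
  dlower_christoffel x u v w z
  - bil (G x) (christoffel G x v w) (christoffel G x u z).
Proof.
move=> Ax; have := is_derive_bil (is_derive_gram u Ax)
  (derivableP (@derivable_christoffel x u v w Ax)) (is_derive_cst z x u).
move=> /(near_eq_is_derive (g := fun y => lower_christoffel y v w z)).
have nE : \forall y \near x,
    bil (G y) (christoffel G y v w) (cst z y) = lower_christoffel y v w z.
  by near=> y; rewrite bil_christoffel//; near: y; exact: nA.
move=> /(_ nE) /(@derive_val _ _ _ _ _ _ _).
rewrite (@derive_val _ _ _ _ _ _ _ (is_derive_lower_christoffel u v w z Ax)).
rewrite -tri_bil bil0r addr0 /= => ->; rewrite bilDl (bil_christoffel _ _ _ Ax).
rewrite (bil_sym (christoffel G x v w) _ (Gs Ax)) (bil_christoffel _ _ _ Ax).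
rewrite (tri_dgramE _ _ _ Ax); ring.
Unshelve. all: by end_near. Qed.

Lemma bil_curvature x u v w z : A x ->
  bil (G x) (curvature_at G x u v w) z =
  dlower_christoffel x u v w z - dlower_christoffel x v u w z
  - bil (G x) (christoffel G x v w) (christoffel G x u z)
  + bil (G x) (christoffel G x u w) (christoffel G x v z).
Proof.
move=> Ax.
have nab a b : nabla G (cst a) (cst b) = fun y => christoffel G y a b.
  by apply/funext => y; rewrite /nabla derive_cst add0r.
have c0 : christoffel G x 0 w = 0.
  apply: (bil_inj (Gu Ax)) => t; rewrite bil0l (bil_christoffel 0 w t Ax).
  exact: lower_christoffel0.
have E1 := bil_derive_christoffel u v w z Ax.
have E2 := bil_derive_christoffel v u w z Ax.
have b0 : bracket (cst u) (cst v) x = 0.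
  by rewrite /bracket !derive_cst oppr0 addr0.
have n0 : nabla G (bracket (cst u) (cst v)) (cst w) x = 0.
  by rewrite {1}/nabla b0 derive_cst add0r.
have cE : curvature_at G x u v w =
    ('D_u (fun y => christoffel G y v w) x
     + christoffel G x u (christoffel G x v w))
    - ('D_v (fun y => christoffel G y u w) x
       + christoffel G x v (christoffel G x u w)).
  by rewrite /curvature_at /curvature n0 oppr0 addr0 !nab.
rewrite cE; apply: etrans (bilDl _ _ _ _) _.
apply: etrans (congr2 +%R E1 (etrans (bilNl _ _ _) (congr1 -%R E2))) _.
move: (dlower_christoffel _ _ _ _ _) (dlower_christoffel _ _ _ _ _).
move: (bil _ _ _) (bil _ _ _) => a b c d.
ring.
Qed.

End LocalMetric.

(** * Constant curvature *)

(** An algebraic curvature tensor. Skew symmetry and pair symmetry carry linearity from the first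
    slot to the others. *)
Definition curvature_like (R : realType) (n : nat)
    (T : 'rV[R]_n -> 'rV[R]_n -> 'rV[R]_n -> 'rV[R]_n -> R) : Prop :=
  [/\ forall a u u' v w z, T (a *: u + u') v w z = a * T u v w z + T u' v w z,
      forall u v w z, T u v w z = - T v u w z,
      forall u v w z, T u v w z = T w z u v &
      forall u v w z, T u v w z + T v w u z + T w u v z = 0].

Section CurvatureLike.
Context {R : realType} {n : nat}.
Local Notation V := 'rV[R]_n.
Implicit Types (u v w z : V).

(** Polarizing in v and then in u makes T skew under exchange of its outer slots, hence of slots 1
    and 3 as well. T is then totally skew, and the Bianchi sum is 3 T. *)
Lemma curvature_like_eq0 (T : V -> V -> V -> V -> R) : curvature_like T ->
  (forall u v, T u v v u = 0) -> forall u v w z, T u v w z = 0.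
Proof.
move=> [lin anti pair bianchi] K.
have anti' u v w z : T u v w z = - T u v z w by rewrite pair anti pair.
have add u u' v w z : T (u + u') v w z = T u v w z + T u' v w z.
  by have := lin 1 u u' v w z; rewrite scale1r mul1r.
have add2 u v v' w z : T u (v + v') w z = T u v w z + T u v' w z.
  by rewrite anti add opprD -!anti.
have add3 u v w w' z : T u v (w + w') z = T u v w z + T u v w' z.
  by rewrite pair add -!(pair u v).
have add4 u v w z z' : T u v w (z + z') = T u v w z + T u v w z'.
  by rewrite pair add2 -!(pair u v).
have K1 u v w : T u v w u = 0.
  have := K u (v + w); rewrite add2 !add3 !K add0r addr0.
  have -> : T u w v u = T u v w u by rewrite pair anti anti' opprK.
  lra.
have K2 u v w z : T u v w z = - T z v w u.
  have := K1 (u + z) v w; rewrite add !add4 !K1 add0r addr0.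
  by move/eqP; rewrite addr_eq0 => /eqP.
have K3 u v w z : T u v w z = - T w v u z by rewrite K2 anti' K2 !opprK.
move=> u v w z; have := bianchi u v w z.
rewrite (anti v w) (K3 w v) (anti w u) (K3 u w) (anti v w) (K3 w v) !opprK.
lra.
Qed.

Lemma poly_eq0_of_roots (p : {poly R}) : (forall t, p.[t] = 0) -> p = 0.
Proof.
move=> p0; apply/eqP/negPn/negP => pn0.
(* [size p] is the degree plus one: these are more distinct roots than a nonzero p can have. *)
pose rs : seq R := [seq i%:R | i <- iota 0 (size p)].
have rs_root : all (root p) rs by apply/allP => t _; rewrite /root p0.
have rs_uniq : uniq rs.
  by rewrite map_inj_uniq ?iota_uniq// => i j /eqP; rewrite eqr_nat => /eqP.
by have := max_poly_roots pn0 rs_root rs_uniq; rewrite size_map size_iota ltnn.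
Qed.

(* K(u + t u0, v + t v0) is a polynomial in t whose product with the area
   polynomial vanishes identically, while the latter is not zero. *)
Lemma curvature_like_plane_eq0 (T : V -> V -> V -> V -> R) (g : 'M[R]_n) u0 v0 :
  curvature_like T -> g^T = g ->
  bil g u0 u0 * bil g v0 v0 - bil g u0 v0 ^+ 2 != 0 ->
  (forall u v, bil g u u * bil g v v - bil g u v ^+ 2 != 0 -> T u v v u = 0) ->
  forall u v, T u v v u = 0.
Proof.
move=> [lin anti pair _] gs area0 K u v.
have anti' a b c d : T a b c d = - T a b d c by rewrite pair anti pair.
have lin2 a b c d e t : T a (b + t *: c) d e = T a b d e + t * T a c d e.
  by rewrite addrC anti lin (anti b) (anti c); ring.
have lin1 a b c d e t : T (b + t *: c) a d e = T b a d e + t * T c a d e.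
  by rewrite addrC lin addrC.
have lin3 a b c d e t : T a d (b + t *: c) e = T a d b e + t * T a d c e.
  by rewrite pair lin1 -!(pair a d).
have lin4 a b c d e t : T a d e (b + t *: c) = T a d e b + t * T a d e c.
  by rewrite pair lin2 -!(pair a d).
(* The coefficient of t^i sums over the choices of i slots filled by u0 or v0. *)
pose k := Poly [:: T u v v u;
  T u0 v v u + T u v0 v u + T u v v0 u + T u v v u0;
  T u0 v0 v u + T u0 v v0 u + T u0 v v u0 + T u v0 v0 u + T u v0 v u0 + T u v v0 u0;
  T u v0 v0 u0 + T u0 v v0 u0 + T u0 v0 v u0 + T u0 v0 v0 u;
  T u0 v0 v0 u0].
have kE t : k.[t] = T (u + t *: u0) (v + t *: v0) (v + t *: v0) (u + t *: u0).
  rewrite horner_Poly /= !(lin1, lin2, lin3, lin4); ring.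
pose ar : {poly R} := Poly [::
  bil g u u * bil g v v - bil g u v ^+ 2;
  2 * (bil g u u0 * bil g v v + bil g u u * bil g v v0)
  - 2 * bil g u v * (bil g u v0 + bil g u0 v);
  bil g u0 u0 * bil g v v + bil g u u * bil g v0 v0 + 4 * bil g u u0 * bil g v v0
  - 2 * bil g u v * bil g u0 v0 - (bil g u v0 + bil g u0 v) ^+ 2;
  2 * (bil g u u0 * bil g v0 v0 + bil g u0 u0 * bil g v v0)
  - 2 * bil g u0 v0 * (bil g u v0 + bil g u0 v);
  bil g u0 u0 * bil g v0 v0 - bil g u0 v0 ^+ 2].
have arE t : ar.[t] = bil g (u + t *: u0) (u + t *: u0)
    * bil g (v + t *: v0) (v + t *: v0) - bil g (u + t *: u0) (v + t *: v0) ^+ 2.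
  rewrite horner_Poly /= !bilE (bil_sym u0 u gs) (bil_sym v0 v gs); ring.
(* The coefficient of t^4 is the area of the nondegenerate plane u0, v0. Polynomials form an
   integral domain, so k = 0, and t = 0 gives the claim. *)
have ar0 : ar != 0.
  apply: contraNneq area0 => ar0; have := congr1 (fun p : {poly R} => p`_4) ar0.
  by rewrite coef_Poly coef0 /= => ->.
have : k * ar = 0.
  apply: poly_eq0_of_roots => t; rewrite hornerM kE arE.
  by have [->|/K ->] := eqVneq (bil g (u + t *: u0) (u + t *: u0) *
    bil g (v + t *: v0) (v + t *: v0) - bil g (u + t *: u0) (v + t *: v0) ^+ 2) 0;
    rewrite ?mulr0 ?mul0r.
move=> /eqP; rewrite mulf_eq0 (negPf ar0) orbF => /eqP k0.
by have := kE 0; rewrite k0 horner0 !scale0r !addr0.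
Qed.

(** T - c G is again curvature-like and vanishes on nondegenerate planes, hence on all planes, hence
    identically. *)
Lemma curvature_like_const (T : V -> V -> V -> V -> R) (g : 'M[R]_n) c u0 v0 :
  curvature_like T -> g^T = g ->
  bil g u0 u0 * bil g v0 v0 - bil g u0 v0 ^+ 2 != 0 ->
  (forall u v, let area := bil g u u * bil g v v - bil g u v ^+ 2 in
    area != 0 -> T u v v u / area = c) ->
  forall u v w z,
    T u v w z = c * (bil g u z * bil g v w - bil g u w * bil g v z).
Proof.
move=> [lin anti pair bianchi] gs area0 K u v w z.
pose D u v w z := T u v w z - c * (bil g u z * bil g v w - bil g u w * bil g v z).
apply/eqP; rewrite -subr_eq0; apply/eqP; rewrite -/(D u v w z).
have DL : curvature_like D.
  split => [a b b' d e f|a b d e|a b d e|a b d e]; rewrite /D.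
  - rewrite lin !bilE; ring.
  - rewrite anti; ring.
  - rewrite pair (bil_sym d b gs) (bil_sym e a gs) (bil_sym d a gs) (bil_sym e b gs).
    ring.
  - have <- := bianchi a b d e.
    rewrite (bil_sym d b gs) (bil_sym b a gs) (bil_sym d a gs); ring.
apply: (curvature_like_eq0 DL) => {u v w z}.
apply: (curvature_like_plane_eq0 DL gs area0) => a b ab.
have := K a b ab => /(canRL (divfK ab)).
by rewrite /D (bil_sym b a gs) -expr2 => ->; rewrite subrr.
Qed.

End CurvatureLike.

Section MetricCurvature.
Context {R : realType} {n : nat}.
Local Notation V := 'rV[R]_n.

(** Here t(a,b,c,d) stands for D_a D_b g(c,d), and c for the product g(Gam, Gam). Only their
    symmetries matter: Schwarz and symmetry of g for t, torsion-freeness and symmetry of g for c. *)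
Lemma curvature_like_formula (t c : V -> V -> V -> V -> R) :
  (forall a u u' v w z, t (a *: u + u') v w z = a * t u v w z + t u' v w z) ->
  (forall a u v w w' z, t u v (a *: w + w') z = a * t u v w z + t u v w' z) ->
  (forall u v w z, t u v w z = t v u w z) ->
  (forall u v w z, t u v w z = t u v z w) ->
  (forall a u u' v w z, c (a *: u + u') v w z = a * c u v w z + c u' v w z) ->
  (forall u v w z, c u v w z = c v u w z) ->
  (forall u v w z, c u v w z = c w z u v) ->
  curvature_like (fun u v w z =>
    2^-1 * (t u v w z + t u w v z - t u z v w)
    - 2^-1 * (t v u w z + t v w u z - t v z u w) - c v w u z + c u w v z).
Proof.
move=> t1 t3 t12 t34 c1 c12 cp.
have c34 u v w z : c u v w z = c u v z w by rewrite cp c12 cp.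
split => [a u u' v w z|u v w z|u v w z|u v w z].
- rewrite !t1 !t3 [t v (_ + _) _ _]t12 t1 (t12 v u) (t12 v u') c1.
  rewrite [c _ _ (_ + _) _]cp c1 !(cp u z) !(cp u' z); ring.
- ring.
- rewrite (t12 v u w z) (t12 z w u v) (t12 w u z v) (t34 u w z v) (t12 w v z u).
  rewrite (t34 v w z u) (t12 z u w v) (t34 u z w v) (t12 z v w u) (t34 v z w u).
  rewrite (cp z u w v) (c12 w v z u) (c34 v w z u) (c12 w u z v) (c34 u w z v).
  by field.
- rewrite (t12 v u w z) (t12 w v u z) (t12 w u v z) (t34 v z w u) (t34 w z v u).
  rewrite (t34 u z w v) (c12 w u v z) (c12 v u w z) (c12 w v u z).
  by field.
Qed.

Lemma curvature_like_metric (A : set V) (G : V -> 'M[R]_n) x :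
  local_metric A G -> A x ->
  curvature_like (fun u v w z => bil (G x) (curvature_at G x u v w) z).
Proof.
move=> mG Ax; have [_ Gs _ _] := mG.
pose t (a b c d : V) := tri (ddgram G x a) b c d.
pose c (a b c d : V) := bil (G x) (christoffel G x a b) (christoffel G x c d).
suff : curvature_like (fun u v w z =>
    2^-1 * (t u v w z + t u w v z - t u z v w)
    - 2^-1 * (t v u w z + t v w u z - t v z u w) - c v w u z + c u w v z).
  congr curvature_like; do 4!apply/funext=> ?.
  exact/esym/(bil_curvature mG).
apply: curvature_like_formula; rewrite /t /c.
(* Linearity in the direction of the outer derivative is not visible in [ddgram]; Schwarz moves this
   direction into a slot of [tri]. *)
- move=> a u u' v w z; apply: etrans (ddgram_schwarz mG _ v w z Ax) _.
  apply: etrans (tri_lin1 _ _ _ _ _ _) _.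
  apply: congr2 (ddgram_schwarz mG v u' w z Ax).
  exact: congr1 (ddgram_schwarz mG v u w z Ax).
- by move=> a u v w w' z; exact: tri_lin2.
- by move=> u v w z; exact: (ddgram_schwarz mG).
- by move=> u v w z; apply: tri_sym23 => *; exact: (ddgram_sym mG).
- move=> a u u' v w z.
  apply: etrans (congr1 (bil (G x) ^~ _) (christoffel_lin1 mG a u u' v Ax)) _.
  by apply: etrans (bilDl _ _ _ _) _; rewrite bilZl.
- move=> u v w z.
  exact: (congr1 (fun p => bil (G x) p (christoffel G x w z))
    (christoffel_sym mG u v Ax)).
- by move=> u v w z; exact: bil_sym (Gs _ Ax).
Qed.

End MetricCurvature.

(** * The Gauss equation *)

Section GaussAlgebra.
Context {R : realType} {m : nat}.
Local Notation W := 'rV[R]_m.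

(** The letters a, b, c are first derivatives of F and [ab] is the second derivative in the
    corresponding directions. In the Koszul combination h(ab, c) occurs twice and the other second
    derivatives cancel. *)
Lemma koszul_immersion (t : W -> W -> W -> R) (h : W -> W -> R)
    (a b c ab ac bc : W) : (forall p q, h p q = h q p) ->
  2^-1 * ((t a b c + h ab c + h b ac) + (t b a c + h ab c + h a bc)
          - (t c a b + h ac b + h a bc)) =
  2^-1 * (t a b c + t b a c - t c a b) + h ab c.
Proof. by move=> hs; rewrite (hs b ac); field. Qed.

(** In the same notation, the terms with the third derivative [abc] and those with L(ab, c, d) occur
    in both lines and cancel. What remains are the terms with second derivatives that occur in the
    products of second fundamental forms. *)
Lemma gauss_codazzi_cancellation (t L : W -> W -> W -> R) (h : W -> W -> R)
    (a b c d ab ac ad bc bd abc : W) (d1 d2 : R) :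
  (forall p q r, t p q r = L p q r + L p r q) ->
  (forall p q r, L p q r = L q p r) ->
  (d1 + L ab c d + L b ac d + L b c ad + (t a bc d + h abc d + h bc ad))
  - (d2 + L ab c d + L a bc d + L a c bd + (t b ac d + h abc d + h ac bd)) =
  d1 - d2 + (h bc ad + L b c ad + L a d bc) - (h ac bd + L a c bd + L b d ac).
Proof. by move=> tE Ls; rewrite !tE; ring. Qed.

(** Z and Z' are the tangential parts of X + Y and X' + Y'. All pairings involving a tangential part
    equal q, so removing them costs -q - q + q = -q. *)
Lemma bil_normal_parts (h : 'M[R]_m) (X Y Z X' Y' Z' : W) (q l l' : R) :
  h^T = h -> bil h Z Z' = q -> bil h (X + Y) Z' = q -> bil h (X' + Y') Z = q ->
  bil h Y X' = l -> bil h Y' X = l' ->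
  bil h (X + Y - Z) (X' + Y' - Z') = bil h X X' + l + l' + bil h Y Y' - q.
Proof.
move=> hs ZZ PZ PZ' <- <-.
rewrite bilDl bilNl bilDr [bil h Z _]bilDr !bilNr PZ ZZ.
rewrite [bil h Z (X' + Y')](bil_sym _ _ hs) PZ' bilDl !bilDr (bil_sym Y' X hs).
ring.
Qed.

Lemma scale_add_sub (a : R) (p p' q q' r r' : W) :
  (a *: p + p') + (a *: q + q') - (a *: r + r') =
  a *: (p + q - r) + (p' + q' - r').
Proof. by apply/rowP=> i; rewrite !mxE; ring. Qed.

Lemma gauss_combination (rg rh dg1 dg2 dh1 dh2 q1 q2 p1 p2 k1 k2 b1 b2 : R) :
  rg = dg1 - dg2 - q1 + q2 -> rh = dh1 - dh2 - p1 + p2 ->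
  dg1 - dg2 = dh1 - dh2 + k1 - k2 ->
  b1 = k1 + p1 - q1 -> b2 = k2 + p2 - q2 ->
  rg = rh + b1 - b2.
Proof. move=> -> -> -> -> ->; ring. Qed.

End GaussAlgebra.

Section GaussEquation.
Context {R : realType} {n m : nat}.
Variables (A : set 'rV[R]_n) (B : set 'rV[R]_m).
Variables (G : 'rV[R]_n -> 'M[R]_n) (H : 'rV[R]_m -> 'M[R]_m).
Variable F : 'rV[R]_n -> 'rV[R]_m.
Hypotheses (mG : local_metric A G) (mH : local_metric B H).
Hypotheses (Fs : smooth_on A F) (AB : forall x, A x -> B (F x)).
Hypothesis GH : forall x, A x -> forall u v,
  bil (G x) u v = bil (H (F x)) ('D_u F x) ('D_v F x).
Implicit Types (x u v w z : 'rV[R]_n).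

Let oA : open A. Proof. by case: mG. Qed.
Let Gu y : A y -> G y \in unitmx. Proof. by case: mG => _ _ /(_ y). Qed.
Let Hs y : B y -> (H y)^T = H y. Proof. by case: mH => _ /(_ y). Qed.
Let nA x : A x -> \forall y \near x, A y.
Proof. by move=> Ax; exact: open_nbhs_nbhs. Qed.

Let Fd x : A x -> differentiable F x.
Proof. exact: smooth_on_differentiable Fs. Qed.

Let Fdd x u : A x -> differentiable ('D_u F) x.
Proof. exact: smooth_on_differentiable (smooth_on_derive u Fs). Qed.

Let DF x u v : A x -> is_derive x u ('D_v F) ('D_u ('D_v F) x).
Proof. by move=> Ax; apply: derivableP; exact: diff_derivable (Fdd v Ax). Qed.

Let DDF x u v w : A x ->
  is_derive x u ('D_v ('D_w F)) ('D_u ('D_v ('D_w F)) x).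
Proof.
move=> Ax; apply: derivableP.
exact: smooth_on_derivable (smooth_on_derive v (smooth_on_derive w Fs)) Ax.
Qed.

Let Fsym x u v : A x -> 'D_u ('D_v F) x = 'D_v ('D_u F) x.
Proof. exact: smooth_on_schwarz_mx oA Fs. Qed.

Lemma is_derive_dgram_along x u i j k : A x ->
  is_derive x u (fun y => dgram H (F y) i j k) (ddgram H (F x) ('D_u F x) i j k).
Proof.
move=> Ax; exact: is_derive_chain (Fd Ax) (differentiable_dgram mH i j k (AB Ax)).
Qed.

Lemma is_derive_gram_along x u : A x -> is_derive x u (H \o F)
  (\matrix_(i, j) \sum_k 'D_u F x 0 k * dgram H (F x) k i j).
Proof.
move=> Ax; apply: is_derive_mx => i j; rewrite mxE.
rewrite -(derive_gram_entry mH _ _ _ (AB Ax)).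
have [_ _ _ Hd] := mH.
exact: is_derive_chain (Fd Ax) (smooth_on_differentiable (Hd i j) (AB Ax)).
Qed.

Lemma is_derive_lower_along x u (a b c : 'rV[R]_n -> 'rV[R]_m) da db dc : A x ->
  is_derive x u a da -> is_derive x u b db -> is_derive x u c dc ->
  is_derive x u (fun y => lower_christoffel H (F y) (a y) (b y) (c y))
    (dlower_christoffel H (F x) ('D_u F x) (a x) (b x) (c x)
     + lower_christoffel H (F x) da (b x) (c x)
     + lower_christoffel H (F x) (a x) db (c x)
     + lower_christoffel H (F x) (a x) (b x) dc).
Proof.
move=> Ax ad bd cd; rewrite /lower_christoffel /dlower_christoffel.
have T (p q r : 'rV[R]_n -> 'rV[R]_m) dp dq dr : is_derive x u p dp ->
    is_derive x u q dq -> is_derive x u r dr ->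
    is_derive x u (fun y => tri (dgram H (F y)) (p y) (q y) (r y))
      (tri (ddgram H (F x) ('D_u F x)) (p x) (q x) (r x)
       + tri (dgram H (F x)) dp (q x) (r x) + tri (dgram H (F x)) (p x) dq (r x)
       + tri (dgram H (F x)) (p x) (q x) dr).
  by apply: is_derive_tri => i j k; exact: is_derive_dgram_along.
apply: is_derive_eq (is_derive_mul (is_derive_cst (2^-1 : R) x u) (is_deriveB
  (is_deriveD (T _ _ _ _ _ _ ad bd cd) (T _ _ _ _ _ _ bd ad cd))
  (T _ _ _ _ _ _ cd ad bd))) _.
rewrite mul0r add0r /cst.
move: (tri _) (tri _) => t t'.
ring.
Qed.

Lemma is_derive_bil_along x u (a b : 'rV[R]_n -> 'rV[R]_m) da db : A x ->
  is_derive x u a da -> is_derive x u b db ->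
  is_derive x u (fun y => bil (H (F y)) (a y) (b y))
    (tri (dgram H (F x)) ('D_u F x) (a x) (b x)
     + bil (H (F x)) da (b x) + bil (H (F x)) (a x) db).
Proof.
move=> Ax ad bd; rewrite tri_bil.
exact: is_derive_bil (is_derive_gram_along u Ax) ad bd.
Qed.

Let Hsym x (p q : 'rV[R]_m) : A x -> bil (H (F x)) p q = bil (H (F x)) q p.
Proof. by move=> Ax; exact: bil_sym (Hs (AB Ax)). Qed.

Lemma lower_christoffel_immersion x v w z : A x ->
  lower_christoffel G x v w z =
  lower_christoffel H (F x) ('D_v F x) ('D_w F x) ('D_z F x)
  + bil (H (F x)) ('D_v ('D_w F) x) ('D_z F x).
Proof.
move=> Ax.
(* X and Y are fixed only up to equality, so that each use can present the mixed derivatives in the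
   order in which they cancel. *)
have D a b c X Y : X = 'D_a ('D_b F) x -> Y = 'D_a ('D_c F) x ->
    tri (dgram G x) a b c =
    tri (dgram H (F x)) ('D_a F x) ('D_b F x) ('D_c F x)
    + bil (H (F x)) X ('D_c F x) + bil (H (F x)) ('D_b F x) Y.
  move=> -> ->; rewrite -(derive_gram mG _ _ _ Ax); apply: derive_val.
  apply: near_eq_is_derive (is_derive_bil_along Ax (DF a b Ax) (DF a c Ax)).
  by near=> y; rewrite GH//; near: y; exact: nA.
rewrite /lower_christoffel (D v w z _ _ erefl erefl).
rewrite (D w v z _ _ (Fsym v w Ax) erefl).
rewrite (D z v w _ _ (Fsym v z Ax) (Fsym w z Ax)).
by apply: koszul_immersion => p q; exact: Hsym.
Unshelve. all: by end_near. Qed.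

(** The derivative along u of [lower_christoffel_immersion]. X and Y again leave the order of the
    partial derivatives open. *)
Lemma dlower_christoffel_immersion x u v w z X Y : A x ->
  X = 'D_u ('D_v F) x -> Y = 'D_u ('D_v ('D_w F)) x ->
  dlower_christoffel G x u v w z =
  dlower_christoffel H (F x) ('D_u F x) ('D_v F x) ('D_w F x) ('D_z F x)
  + lower_christoffel H (F x) X ('D_w F x) ('D_z F x)
  + lower_christoffel H (F x) ('D_v F x) ('D_u ('D_w F) x) ('D_z F x)
  + lower_christoffel H (F x) ('D_v F x) ('D_w F x) ('D_u ('D_z F) x)
  + (tri (dgram H (F x)) ('D_u F x) ('D_v ('D_w F) x) ('D_z F x)
     + bil (H (F x)) Y ('D_z F x)
     + bil (H (F x)) ('D_v ('D_w F) x) ('D_u ('D_z F) x)).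
Proof.
move=> Ax -> ->; have [_ <-] := is_derive_lower_christoffel mG u v w z Ax.
apply: derive_val.
apply: near_eq_is_derive (is_deriveD
  (is_derive_lower_along Ax (DF u v Ax) (DF u w Ax) (DF u z Ax))
  (is_derive_bil_along Ax (DDF u v w Ax) (DF u z Ax))).
near=> y; apply: esym; apply: lower_christoffel_immersion.
by near: y; exact: nA.
Unshelve. all: by end_near. Qed.

(** The vector-valued second fundamental form: the ambient covariant derivative of dF(v) along dF(u)
    minus dF of the intrinsic one. It involves no choice of a normal vector. *)
Definition second_form x u v : 'rV[R]_m :=
  'D_u ('D_v F) x + christoffel H (F x) ('D_u F x) ('D_v F x)
  - 'D_(christoffel G x u v) F x.

Let tangent x u v w : A x ->
  bil (H (F x)) ('D_u ('D_v F) x + christoffel H (F x) ('D_u F x) ('D_v F x))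
    ('D_w F x) = bil (G x) (christoffel G x u v) w.
Proof.
move=> Ax; apply: etrans (bilDl _ _ _ _) _.
apply: etrans _ (esym (bil_christoffel mG u v w Ax)).
apply: etrans _ (esym (lower_christoffel_immersion u v w Ax)).
apply: etrans (addrC _ _) _; apply: congr2 => //.
exact: (bil_christoffel mH _ _ _ (AB Ax)).
Qed.

Lemma second_form_normal x u v w : A x ->
  bil (H (F x)) (second_form x u v) ('D_w F x) = 0.
Proof.
move=> Ax; apply: etrans (bilDl _ _ _ _) _; rewrite (tangent u v w Ax).
by rewrite bilNl -(GH Ax) subrr.
Qed.

Lemma second_form_sym x u v : A x -> second_form x u v = second_form x v u.
Proof.
move=> Ax; exact: (congr2 (fun p q => p - q)
  (congr2 +%R (Fsym u v Ax) (christoffel_sym mH _ _ (AB Ax)))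
  (congr1 (fun t => 'D_t F x) (christoffel_sym mG u v Ax))).
Qed.

Lemma second_form_lin1 x a u u' v : A x ->
  second_form x (a *: u + u') v = a *: second_form x u v + second_form x u' v.
Proof.
move=> Ax; rewrite /second_form.
rewrite (derive_is_linear (Fdd v Ax) a u u') (derive_is_linear (Fd Ax) a u u').
rewrite (christoffel_lin1 mH a _ _ _ (AB Ax)) (christoffel_lin1 mG a u u' v Ax).
rewrite (derive_is_linear (Fd Ax) a).
exact: scale_add_sub.
Qed.

Lemma gauss_equation x u v w z : A x ->
  bil (G x) (curvature_at G x u v w) z =
  bil (H (F x)) (curvature_at H (F x) ('D_u F x) ('D_v F x) ('D_w F x)) ('D_z F x)
  + bil (H (F x)) (second_form x v w) (second_form x u z)
  - bil (H (F x)) (second_form x u w) (second_form x v z).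
Proof.
move=> Ax; have Bx := AB Ax.
(* The tangential parts contribute exactly the g(Gam, Gam) terms of the curvature of G, and the
   ambient symbols those of the curvature of H. *)
have BB a b c d : bil (H (F x)) (second_form x a b) (second_form x c d) =
    bil (H (F x)) ('D_a ('D_b F) x) ('D_c ('D_d F) x)
    + lower_christoffel H (F x) ('D_a F x) ('D_b F x) ('D_c ('D_d F) x)
    + lower_christoffel H (F x) ('D_c F x) ('D_d F x) ('D_a ('D_b F) x)
    + bil (H (F x)) (christoffel H (F x) ('D_a F x) ('D_b F x))
        (christoffel H (F x) ('D_c F x) ('D_d F x))
    - bil (G x) (christoffel G x a b) (christoffel G x c d).
  apply: bil_normal_parts.
  - exact: Hs.
  - exact: esym (GH Ax _ _).
  - exact: tangent.
  - apply: etrans (tangent c d (christoffel G x a b) Ax) _.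
    by case: mG => _ Gs _ _; exact: bil_sym (Gs _ Ax).
  - exact: (bil_christoffel mH).
  - exact: (bil_christoffel mH).
have e1 := dlower_christoffel_immersion z Ax
  (erefl ('D_u ('D_v F) x)) (erefl ('D_u ('D_v ('D_w F)) x)).
(* D_v D_u is presented as D_u D_v, so that second and third derivatives match those in [e1]. *)
have e2 := dlower_christoffel_immersion z Ax (Fsym u v Ax)
  (smooth_on_schwarz_mx u v oA (smooth_on_derive w Fs) Ax).
apply: (gauss_combination (bil_curvature mG u v w z Ax)
  (bil_curvature mH _ _ _ _ Bx) _ (BB v w u z) (BB u w v z)).
apply: etrans (congr2 (fun p q => p - q) e1 e2) _.
apply: gauss_codazzi_cancellation => p q r.
- exact: (tri_dgramE mH).
- exact: (lower_christoffel_sym mH).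
Qed.

End GaussEquation.

(** * Normal directions, charts, and the Gauss equation on manifolds *)

Lemma bil_form_mx (R : realType) (n : nat) (b : 'rV[R]_n -> 'rV[R]_n -> R) :
  (forall a u u' v, b (a *: u + u') v = a * b u v + b u' v) ->
  (forall u v, b u v = b v u) ->
  forall u v, bil (form_mx b) u v = b u v.
Proof.
move=> bl bs u v; rewrite bilE_sum (lin_delta (fun a x y => bl a x y v) u).
apply: eq_bigr => i _; rewrite bs (lin_delta (fun a x y => bl a x y _) v).
rewrite mulr_sumr; apply: eq_bigr => j _.
by rewrite mxE bs mulrA.
Qed.

(** The vectors orthogonal to the rows of J form the left kernel of h J^T, of dimension (n+1) - n =
    1; xi spans it. *)
Lemma normal_line (R : realType) (n : nat) (J : 'M[R]_(n, n.+1))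
    (h : 'M[R]_n.+1) :
  h \in unitmx -> h^T = h -> row_free J ->
  exists xi : 'rV[R]_n.+1, forall w, (forall i, bil h w (row i J) = 0) ->
    exists a, w = a *: xi.
Proof.
move=> hu hs Jf; pose K := h *m J^T.
have rK : \rank (kermx K) = 1%N.
  rewrite mxrank_ker -mxrank_tr trmx_mul trmxK hs mxrankMfree ?row_free_unit//.
  by move: Jf; rewrite -row_leq_rank => /eqP; rewrite subSn ?rank_leq_row// => ->.
have [p [xi pxi]] : exists (p : 'cV[R]_n.+1) (xi : 'rV[R]_n.+1),
    kermx K = p *m xi.
  have := mulmx_base (kermx K); move: (col_base _) (row_base _).
  by rewrite rK => p xi <-; exists p, xi.
exists xi => w w0.
have : (w <= kermx K)%MS.
  apply/sub_kermxP; apply/rowP=> i; rewrite [RHS]mxE -(w0 i) /bil /K mulmxA.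
  by rewrite tr_row [col i _]colE mulmxA -colE [RHS]mxE.
case/submxP => D ->; exists ((D *m p) 0 0).
by rewrite pxi mulmxA {1}[D *m p]mx11_scalar mul_scalar_mx.
Qed.

(** Two vectors of an orthonormal basis span a plane of area 1 or -1. This is the starting plane for
    [curvature_like_const]. *)
Lemma signature_plane (R : realType) (m : nat) (h : 'M[R]_m) s : (1 < m)%N ->
  gram_signature h s -> exists u v,
    bil h u u * bil h v v - bil h u v ^+ 2 != 0.
Proof.
move=> m1 [_ [P _ PhP]].
have hP i j : bil h (row i P) (row j P) =
    (diag_mx (\row_(i < m) if (i < s)%N then -1 else 1) : 'M[R]_m) i j.
  by rewrite -PhP /bil tr_row -row_mul colE mulmxA -colE -row_mul !mxE.
pose i0 := Ordinal (ltnW m1); pose i1 := Ordinal m1.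
exists (row i0 P), (row i1 P); rewrite !hP !mxE /= !mulr1n mulr0n expr0n subr0.
by case: ifP; case: ifP; rewrite ?mulrN1 ?mulN1r ?mul1r ?opprK ?oppr_eq0 oner_eq0.
Qed.

Lemma smooth_on_sub (R : realType) (V W : normedModType R) (A B : set V)
  (f : V -> W) : A `<=` B -> smooth_on B f -> smooth_on A f.
Proof.
move=> AB fs k; have := fs k; elim: k f {fs} => [|k IH] f /=.
  by move=> fB x /AB; exact: fB.
by move=> [fB fk]; split=> [x /AB|v]; [exact: fB|exact: IH].
Qed.

Lemma chart_local_metric (R : realType) (n : nat) (M : manifold R n)
  (g : metric M) phi (A : set 'rV[R]_n) : atlas phi -> open A ->
  A `<=` phi @` cdom phi ->
  local_metric A (fun x => g phi (cinv phi x)).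
Proof.
move=> aphi oA Aphi; have [_ _ cK _ _] := atlas_chart aphi; split => //.
- by move=> _ /Aphi[q pq <-]; rewrite cK// gram_sym.
- by move=> _ /Aphi[q pq <-]; rewrite cK// gram_nondeg.
- by move=> i j; exact: smooth_on_sub (gram_smooth g aphi i j).
Qed.

Lemma open_chart_preimage (R : realType) (n : nat) (M : manifold R n)
  (T : topologicalType) (f : M -> T) phi (D : set T) :
  continuous f -> atlas phi -> open D -> open (phi @` (cdom phi `&` f @^-1` D)).
Proof.
move=> fc aphi oD; have [odom oim cK _ cc] := atlas_chart aphi.
rewrite openE => _ [q [pq fq] <-]; rewrite /interior.
have xq : (phi @` cdom phi) (phi q) by exists q.
have n1 : \forall y \near phi q, (phi @` cdom phi) y by exact: open_nbhs_nbhs.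
have n2 : \forall y \near phi q, D (f (cinv phi y)).
  have nD : nbhs (f q) D by exact: open_nbhs_nbhs.
  have := cc _ xq; rewrite /prop_for /continuous_at cK//.
  by move=> /(_ _ (fc q _ nD)).
apply: filterS2 n1 n2 => _ [r pr <-] Dr; exists r => //; split=> //.
by move: Dr; rewrite cK.
Qed.

Section ConstantCurvature.
Context {R : realType} {m : nat} {N : manifold R m}.
Variables (h : metric N) (s : nat) (c : R).
Hypotheses (m1 : (1 < m)%N) (hs : has_signature h s).
Hypothesis hc : constant_curvature h c.

Lemma constant_curvature_Riem q psi : chart_at q psi -> forall X Y Z W,
  Riem h psi q X Y Z W = c * (gT h psi q X W * gT h psi q Y Z
                              - gT h psi q X Z * gT h psi q Y W).
Proof.
move=> cq X Y Z W; have [apsi pq] := cq.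
have [_ oim cK _ _] := atlas_chart apsi.
have mH := chart_local_metric h apsi oim (@subset_refl _ _).
have xq : (psi @` cdom psi) (psi q) by exists q.
have := curvature_like_metric mH xq; rewrite cK// => CL.
have [u [v uv]] := signature_plane m1 (hs cq).
exact: (curvature_like_const CL (gram_sym h cq) uv (hc cq)).
Qed.

Lemma constant_curvature_scal q psi : chart_at q psi ->
  scal h psi q = c * (m%:R - 1) * m%:R.
Proof.
move=> cq; have gu := gram_nondeg h cq.
(* Constant curvature is the Gauss form with zero second fundamental form, so [gauss_ricci]
   applies. *)
have RE X Y Z W : bil (h psi q) (Rop h psi q X Y Z) W =
    gauss_form (h psi q) 0 0 c X Y Z W.
  apply: etrans (constant_curvature_Riem cq X Y Z W) _.
  by rewrite /gauss_form mul0r add0r.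
rewrite /scal /Ric (gauss_ricci gu RE) scal_bil /gauss_ricci_mx scale0r add0r.
by rewrite -scalemxAl mulmxV// mxtraceZ mxtrace1.
Qed.

End ConstantCurvature.

(** The form b and the scalar e may depend on the point and on both charts; this is harmless, as the
    identities to be proved are pointwise and mention neither. *)
Lemma hypersurface_gauss (R : realType) (n : nat) (c : R)
    (M : manifold R n) (g : metric M) (N : manifold R n.+1) (h : metric N)
    (f : M -> N) p phi psi :
  isometric_immersion g h f -> chart_at p phi -> chart_at (f p) psi ->
  (forall X Y Z W, Riem h psi (f p) X Y Z W =
     c * (gT h psi (f p) X W * gT h psi (f p) Y Z
          - gT h psi (f p) X Z * gT h psi (f p) Y W)) ->
  exists (b : 'M[R]_n) e, b^T = b /\
    forall X Y Z W, Riem g phi p X Y Z W = gauss_form (g phi p) b e c X Y Z W.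
Proof.
move=> [fc ff] cp cq hc; have [aphi pp] := cp; have [apsi pq] := cq.
have [odom oim cK _ _] := atlas_chart apsi.
have [_ _ cK' _ _] := atlas_chart aphi.
pose A := phi @` (cdom phi `&` f @^-1` cdom psi).
pose F := psi \o f \o cinv phi.
have oA : open A by exact: open_chart_preimage.
have mG : local_metric A (fun x => g phi (cinv phi x)).
  by apply: chart_local_metric => // _ [q [q1 _] <-]; exists q.
have mH := chart_local_metric h apsi oim (@subset_refl _ _).
have [Fs Fiso] := ff phi psi aphi apsi.
have AB x : A x -> (psi @` cdom psi) (F x).
  by move=> [q [q1 q2] <-]; exists (f q) => //; rewrite /F /= cK'.
have DE x u : A x -> 'D_u F x = 'd F x u.
  by move=> Ax; exact: deriveE (smooth_on_differentiable Fs Ax).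
have GH x : A x -> forall u v, bil (g phi (cinv phi x)) u v =
    bil (h psi (cinv psi (F x))) ('D_u F x) ('D_v F x).
  move=> Ax u v; rewrite !DE//; case: Ax => q [q1 q2] <-.
  by rewrite /F /= cK'// cK//; exact: (Fiso q q1 q2).2.
have Ax : A (phi p) by exists p.
have Fx : F (phi p) = psi (f p) by rewrite /F /= cK'.
have hu := gram_nondeg h cq; have hs := gram_sym h cq.
have hF : h psi (cinv psi (F (phi p))) = h psi (f p) by rewrite Fx cK.
pose J : 'M[R]_(n, n.+1) := \matrix_i 'D_(delta_mx 0 i) F (phi p).
have JE v : v *m J = 'D_v F (phi p).
  rewrite DE// [in RHS](row_sum_delta v) linear_sum /=.
  apply/rowP=> j; rewrite !mxE summxE; apply: eq_bigr => i _.
  by rewrite linearZ /= mxE mxE DE.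
have Jf : row_free J.
  rewrite -kermx_eq0; apply/eqP/row_matrixP => i; rewrite row0.
  apply: (Fiso p pp pq).1; rewrite -DE// -JE -row_mul mulmx_ker.
  by rewrite row0.
have [xi xiP] := normal_line hu hs Jf.
pose II := second_form (fun x => g phi (cinv phi x))
  (fun y => h psi (cinv psi y)) F (phi p).
have IIxi u v : exists a, II u v = a *: xi.
  apply: xiP => i; rewrite rowK -hF.
  exact: (second_form_normal mG mH Fs AB GH).
have IIsym u v : II u v = II v u by exact: (second_form_sym mG mH Fs AB).
have IIlin a u u' v : II (a *: u + u') v = a *: II u v + II u' v.
  exact: (second_form_lin1 mG mH Fs AB).
have gauss X Y Z W : Riem g phi p X Y Z W =
    Riem h psi (f p) ('D_X F (phi p)) ('D_Y F (phi p)) ('D_Z F (phi p))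
      ('D_W F (phi p))
    + bil (h psi (f p)) (II Y Z) (II X W) - bil (h psi (f p)) (II X Z) (II Y W).
  have := gauss_equation mG mH Fs AB GH X Y Z W Ax.
  by rewrite cK'// hF -/F Fx.
clearbody II.
have [b [bl bs bxi]] : exists b : 'rV[R]_n -> 'rV[R]_n -> R,
    [/\ forall a u u' v, b (a *: u + u') v = a * b u v + b u' v,
        forall u v, b u v = b v u & forall u v, II u v = b u v *: xi].
  (* If xi = 0 the second fundamental form vanishes and b = 0 serves. Otherwise b is read off from a
     nonzero coordinate of xi, and so inherits linearity and symmetry. *)
  have [xi0|] := eqVneq xi 0.
    exists (fun _ _ => 0); split=> [a u u' v|//|u v]; first by rewrite mulr0 addr0.
    by have [a ->] := IIxi u v; rewrite xi0 !scaler0.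
  case/rV0Pn => j xij; exists (fun u v => II u v 0 j / xi 0 j); split.
  - by move=> a u u' v; rewrite IIlin !mxE mulrDl mulrA.
  - by move=> u v; rewrite IIsym.
  - by move=> u v; have [a ->] := IIxi u v; rewrite mxE mulfK.
exists (form_mx b), (bil (h psi (f p)) xi xi); split.
  by apply/matrixP => i j; rewrite !mxE bs.
have gT_F X Y : gT h psi (f p) ('D_X F (phi p)) ('D_Y F (phi p)) =
    bil (g phi p) X Y.
  by have := GH _ Ax X Y; rewrite hF cK'.
move=> X Y Z W; rewrite gauss hc !bxi !bilE.
rewrite (gT_F X W) (gT_F Y Z) (gT_F X Z) (gT_F Y W).
rewrite /gauss_form !(bil_form_mx bl bs); ring.
Qed.

Theorem theorem3p7 (R : realType) (n s : nat) (c kt : R)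
    (M : manifold R n) (g : metric M)
    (N : manifold R n.+1) (h : metric N) (f : M -> N)
    (hn : (4 <= n)%N)
    (hs : has_signature h s)
    (hc : constant_curvature h c)
    (hkt : scalar_curvature_is h kt)
    (hf : isometric_immersion g h f) :
  let k := (n%:R - 2) * kt / (n%:R * (n%:R + 1)) in
  let a := ((n%:R - 2) ^+ 2)^-1 in
  let W (phi : chart R n M) (p : M) X1 X2 X3 X4 :=
    (n%:R - 2) / 2 * wedge (Ric g phi p) (Ric g phi p) X1 X2 X3 X4
    - scal g phi p * wedge (gT g phi p) (Ric g phi p) X1 X2 X3 X4
    + wedge (gT g phi p) (Ric2 g phi p) X1 X2 X3 X4 in
  let CRRC (phi : chart R n M) (p : M) X1 X2 X3 X4 X Y :=
    dotT g phi p (Weyl g phi p) (Riem g phi p) X1 X2 X3 X4 X Y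
    + dotT g phi p (Riem g phi p) (Weyl g phi p) X1 X2 X3 X4 X Y in
  [/\ c = kt / (n%:R * (n%:R + 1)),
      forall (p : M) phi, chart_at p phi -> forall X1 X2 X3 X4 X Y,
        CRRC phi p X1 X2 X3 X4 X Y =
        Q (Ric g phi p) (Weyl g phi p) X1 X2 X3 X4 X Y
        - k * Q (gT g phi p) (Weyl g phi p) X1 X2 X3 X4 X Y
        + dotT g phi p (Weyl g phi p) (Weyl g phi p) X1 X2 X3 X4 X Y
        - a * Q (gT g phi p) (W phi p) X1 X2 X3 X4 X Y,
      forall L_C : M -> R,
        weyl_pseudosymmetric_on g (US g `&` UC g) L_C ->
        forall (p : M) phi, (US g `&` UC g) p -> chart_at p phi ->
        forall X1 X2 X3 X4 X Y,
        CRRC phi p X1 X2 X3 X4 X Y =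
        Q (Ric g phi p) (Weyl g phi p) X1 X2 X3 X4 X Y
        + (L_C p - k) * Q (gT g phi p) (Weyl g phi p) X1 X2 X3 X4 X Y
        - a * Q (gT g phi p) (W phi p) X1 X2 X3 X4 X Y &
      forall alpha L_C : M -> R,
        quasi_einstein g alpha ->
        weyl_pseudosymmetric_on g (US g `&` UC g) L_C ->
        forall (p : M) phi, (US g `&` UC g) p -> chart_at p phi ->
        forall X1 X2 X3 X4 X Y,
        CRRC phi p X1 X2 X3 X4 X Y =
        Q (Ric g phi p) (Weyl g phi p) X1 X2 X3 X4 X Y
        + (L_C p - k) * Q (gT g phi p) (Weyl g phi p) X1 X2 X3 X4 X Y].
Proof.
move=> k a W CRRC.
have n0 : (n%:R : R) != 0 by rewrite pnatr_eq0 -lt0n; apply: leq_trans hn.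
have n10 : (n%:R + 1 : R) != 0 by rewrite natr1 pnatr_eq0.
have n1 : (1 < n.+1)%N by rewrite ltnS; apply: leq_trans hn.
have ckt : c = kt / (n%:R * (n%:R + 1)).
  (* Both c and kt are constants, so comparing them at one point of N suffices; in dimension n+1 the
     scalar curvature is c n (n+1). *)
  have [q _] := manifold_nonempty N; have [psi apsi qpsi] := atlas_cover q.
  have := constant_curvature_scal n1 hs hc (conj apsi qpsi).
  rewrite (hkt _ _ (conj apsi qpsi)) => ->; rewrite -natr1.
  by field; rewrite n0 n10.
have kc : k = (n%:R - 2) * c by rewrite /k ckt mulrA.
have gauss p phi : chart_at p phi -> exists (b : 'M[R]_n) e, b^T = b /\
    forall X Y Z W, Riem g phi p X Y Z W = gauss_form (g phi p) b e c X Y Z W.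
  move=> cp; have [psi apsi fpsi] := atlas_cover (f p).
  apply: (hypersurface_gauss hf cp (conj apsi fpsi)).
  exact: (constant_curvature_Riem n1 hs hc (conj apsi fpsi)).
have main p phi : chart_at p phi -> forall X1 X2 X3 X4 X Y,
    CRRC phi p X1 X2 X3 X4 X Y =
    Q (Ric g phi p) (Weyl g phi p) X1 X2 X3 X4 X Y
    - k * Q (gT g phi p) (Weyl g phi p) X1 X2 X3 X4 X Y
    + dotT g phi p (Weyl g phi p) (Weyl g phi p) X1 X2 X3 X4 X Y
    - a * Q (gT g phi p) (W phi p) X1 X2 X3 X4 X Y.
  move=> cp X1 X2 X3 X4 X Y; have [b [e [bs RE]]] := gauss p phi cp.
  rewrite kc; apply: gauss_weyl_identity bs RE.
  - exact: leq_trans hn.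
  - exact: gram_nondeg cp.
  - exact: gram_sym cp.
have collect (q r l x : R) :
    q - k * r + l * r - a * x = q + (l - k) * r - a * x.
  by ring.
have main_L L p phi : weyl_pseudosymmetric_on g (US g `&` UC g) L ->
    (US g `&` UC g) p -> chart_at p phi -> forall X1 X2 X3 X4 X Y,
    CRRC phi p X1 X2 X3 X4 X Y =
    Q (Ric g phi p) (Weyl g phi p) X1 X2 X3 X4 X Y
    + (L p - k) * Q (gT g phi p) (Weyl g phi p) X1 X2 X3 X4 X Y
    - a * Q (gT g phi p) (W phi p) X1 X2 X3 X4 X Y.
  move=> wp pU cp X1 X2 X3 X4 X Y; rewrite (main p phi cp) (wp p phi pU cp).
  exact: collect.
split=> //; first by move=> L wp p phi pU cp; exact: main_L.
move=> al L qe wp p phi pU cp X1 X2 X3 X4 X Y.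
rewrite (main_L L p phi wp pU cp); have [b [e [bs RE]]] := gauss p phi cp.
have gu := gram_nondeg g cp.
have SE : Ric g phi p = bil (gauss_ricci_mx (g phi p) b e c).
  exact: (gauss_ricci gu RE).
rewrite [X in _ - a * X](_ : _ = 0) ?mulr0 ?subr0//.
(* The rank condition is available because p lies in [US g]. Once S is a matrix form, [form_mx] of S
   - alpha g is the matrix difference in [rank1_quasi_einstein]. *)
have := qe p phi pU.1 cp; rewrite /W /scal /Ric2 SE.
move: (gauss_ricci_mx _ _ _ _) => r rk.
apply: (rank1_quasi_einstein (al := al p)) => //; first exact: gram_sym cp.
rewrite -[RHS]rk; congr (\rank _).
by apply/matrixP => i j; rewrite !mxE /gT !bil_delta.
Qed.
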